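(* Let $\rho\in(0,1)$. There is a constant $C>0$ depending only on $\rho$ such that the following holds for all $n,p$, every $X\in\mathbb{R}^{n\times p}$, every $y\in\mathbb{R}^n$ and every deterministic $q\in\mathbb{R}^p$ with $\|q\|=1$. If $\|A_p\|_4\le \rho$, then $$|\delta(y,X)-q^\top u|\le C\sqrt{p}\,\alpha_p,$$ and consequently $$\mathbb{E}_{\nu_{y,X}}\big(q^\top\beta-q^\top u\big)^2-\mathbb{E}_{\nu_{y,X}}\big(q^\top\beta-\delta(y,X)\big)^2\le C\,p\,\alpha_p^2 ,$$ where $\delta(y,X)=\mathbb{E}_{\nu_{y,X}}[q^\top\beta]$ is the posterior mean and $u$ is the mean vector of the mean-field approximation of the posterior.
   Context: $\mu$ is a nondegenerate probability measure on $\mathbb{R}$ supported on $[-1,1]$ (the prior) and $\sigma^2>0$ is known. For $X\in\mathbb{R}^{n\times p}$ and $y\in\mathbb{R}^n$ put $\Sigma_p=\sigma^{-2}X^\top X$, $d_i=\Sigma_p(i,i)$, and let $A_p=-\mathrm{Off}(\Sigma_p)$, i.e. $A_p(i,j)=-\Sigma_p(i,j)$ for $i\ne j$ and $A_p(i,i)=0$. Put $c=\sigma^{-2}X^\top y$. Let $\mu_i$ be the probability measure with $\frac{d\mu_i}{d\mu}(z)\propto e^{-d_iz^2/2}$ and $\psi_i(\theta)=\log\int e^{\theta z}d\mu_i(z)$. The posterior is the probability measure on $[-1,1]^p$ $$\nu_{y,X}(d\beta)\propto\exp\Big(\tfrac12\beta^\top A_p\beta+c^\top\beta\Big)\prod_{i=1}^p\mu_i(d\beta_i)\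 \propto\ \exp\Big(-\tfrac{\|y-X\beta\|^2}{2\sigma^2}\Big)\prod_{i=1}^p\mu(d\beta_i).$$ $\|\cdot\|$ is the Euclidean norm on vectors, $\|M\|_4$ is the $\ell_4\to\ell_4$ operator norm of a matrix, and $\alpha_p=\max_{1\le i\le p}\sum_{j=1}^pA_p(i,j)^2$. Mean-field approximation: when $\|A_p\|_4\le\rho<1$, the minimization of $\mathrm{KL}(Q\,|\,\nu_{y,X})$ over product probability measures $Q=\prod_iQ_i$ on $[-1,1]^p$ has a unique minimizer $Q^{\mathrm{prod}}$; its mean vector $u=(u_1,\dots,u_p)$ is the unique solution of $u_i=\psi_i'(s_i+c_i)$, $s_i=\sum_{j=1}^pA_p(i,j)u_j$, $1\le i\le p$. *)

(* Defs.v *)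
From HB Require Import structures.
From mathcomp Require Import all_boot all_order all_algebra.
From mathcomp Require Import all_classical all_reals all_analysis.
From mathcomp Require Import measurable_realfun.

Set Implicit Arguments.
Unset Strict Implicit.
Unset Printing Implicit Defensive.

Import Order.TTheory GRing.Theory Num.Theory.
Import numFieldNormedType.Exports.

Local Open Scope classical_set_scope.
Local Open Scope ring_scope.

(* Measures on R^p live on p-tuples, which carry the product sigma-algebra;
   [vec] turns a tuple into a column vector. *)
Notation Rmeas R := (measurableTypeR R).

Definition vec (R : realType) (p : nat) (b : p.-tuple (Rmeas R)) : 'cV[R]_p :=
  \col_i (tnth b i : R).

Section Vectors.
Context {R : realType}.

Definition dotv p (u v : 'cV[R]_p) : R := \sum_i u i 0 * v i 0.

Definition norm2 p (x : 'cV[R]_p) : R := Num.sqrt (\sum_i x i 0 ^+ 2).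

Definition norm4 p (x : 'cV[R]_p) : R := (\sum_i `|x i 0| ^+ 4) `^ (4%:R^-1).

(* l4 -> l4 operator norm: the supremum is over a nonempty bounded set, so it
   is not a default value of [sup]. *)
Definition opnorm4 p (M : 'M[R]_p) : R :=
  sup [set norm4 (M *m x) | x in [set x | norm4 x <= 1]].

Definition Sigma n p (s2 : R) (X : 'M[R]_(n, p)) : 'M[R]_p :=
  s2^-1 *: (X^T *m X).

(* A = - Off(Sigma) *)
Definition Amat n p (s2 : R) (X : 'M[R]_(n, p)) : 'M[R]_p :=
  \matrix_(i, j) (if i == j then 0 else - Sigma s2 X i j).

(* The default 0 of the maximum is harmless: the sums are nonnegative. *)
Definition alpha n p (s2 : R) (X : 'M[R]_(n, p)) : R :=
  \big[Num.max/0]_(i < p) \sum_(j < p) Amat s2 X i j ^+ 2.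

End Vectors.

Section ProductProbability.
Context {R : realType}.

Definition consT p (z : Rmeas R * p.-tuple (Rmeas R)) :
  p.+1.-tuple (Rmeas R) := [tuple of z.1 :: z.2].

Lemma measurable_consT p : measurable_fun [set: _] (@consT p).
Proof. exact: measurable_cons. Qed.

HB.instance Definition _ p :=
  @isMeasurableFun.Build _ _ _ _ (@consT p) (@measurable_consT p).

Section Pair.
Context d1 d2 (T1 : measurableType d1) (T2 : measurableType d2).
Variables (P1 : probability T1 R) (P2 : probability T2 R).

Definition pair_prob : set (T1 * T2) -> \bar R := (P1 \x P2)%E.

HB.instance Definition _ := Measure.on pair_prob.

Let pair_probT : pair_prob setT = 1%E.
Proof.
rewrite /pair_prob -setXTT product_measure1E//.
rewrite -[RHS]mule1; congr (_ * _)%E; exact: probability_setT.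
Qed.

HB.instance Definition _ := Measure_isProbability.Build _ _ _
  pair_prob pair_probT.
End Pair.

(* P 0 (x) P 1 (x) ... (x) P (p-1), as a probability measure on R^p *)
Fixpoint prod_prob p :
    ('I_p -> probability (Rmeas R) R) -> probability (p.-tuple (Rmeas R)) R :=
  match p with
  | 0 => fun=> \d_([tuple])
  | p'.+1 => fun P =>
      distribution (pair_prob (P ord0) (prod_prob (fun i => P (lift ord0 i))))
                   (@consT p')
  end.

End ProductProbability.

(* Linear model y = X b + noise, noise variance s2, i.i.d. prior mu on the
   coordinates of b; the likelihood is taken up to a factor free of b. *)
Section Posterior.
Context {R : realType}.
Variables (mu : probability (Rmeas R) R) (s2 : R) (n p : nat).
Variables (X : 'M[R]_(n, p)) (y : 'cV[R]_n).

Definition likelihood (b : p.-tuple (Rmeas R)) : R :=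
  expR (- (norm2 (y - X *m vec b) ^+ 2 / (2 * s2))).

Definition prior : probability (p.-tuple (Rmeas R)) R := prod_prob (fun=> mu).

Definition unnormalized_posterior (B : set (p.-tuple (Rmeas R))) : \bar R :=
  (\int[prior]_(b in B) (likelihood b)%:E)%E.

Lemma measurable_likelihood : measurable_fun [set: _] likelihood.
Proof.
apply: measurableT_comp => //; apply: measurableT_comp => //.
apply: measurable_funM => //.
rewrite (_ : (fun _ => _) = (fun b : p.-tuple (Rmeas R) =>
  \sum_i (y i 0 - \sum_j X i j * (tnth b j : R)) ^+ 2)).
  apply: measurable_sum => i; apply: measurable_funX.
  apply: measurable_funB => //; apply: measurable_sum => j.
  by apply: measurable_funM => //; exact: measurable_tnth.
apply/funext => b; rewrite /norm2 sqr_sqrtr; last first.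
  by apply: sumr_ge0 => i _; exact: sqr_ge0.
apply: eq_bigr => i _; rewrite !mxE; congr ((_ - _) ^+ 2).
by apply: eq_bigr => j _; rewrite mxE.
Qed.

Let unnormalized_posterior0 : unnormalized_posterior set0 = 0%E.
Proof. by rewrite /unnormalized_posterior integral_set0. Qed.

Let unnormalized_posterior_ge0 B : (0 <= unnormalized_posterior B)%E.
Proof. by apply: integral_ge0 => b _; rewrite lee_fin expR_ge0. Qed.

Let unnormalized_posterior_sigma_additive :
  semi_sigma_additive unnormalized_posterior.
Proof.
move=> B mB tB mUB; rewrite /unnormalized_posterior ge0_integral_bigcup//.
- apply: is_cvg_ereal_nneg_natsum_cond => k _ _.
  by apply: integral_ge0 => b _; rewrite lee_fin expR_ge0.
- by apply/measurable_funTS/measurable_EFinP; exact: measurable_likelihood.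
- by move=> b _; rewrite lee_fin expR_ge0.
Qed.

HB.instance Definition _ := isMeasure.Build _ _ _ unnormalized_posterior
  unnormalized_posterior0 unnormalized_posterior_ge0
  unnormalized_posterior_sigma_additive.

(* The normalizing constant lies in ]0, 1], so that the default value of
   [mnormalize] (its second argument) is never used. *)
Definition posterior : probability (p.-tuple (Rmeas R)) R :=
  mnormalize unnormalized_posterior prior.

End Posterior.

Section MeanField.
Context {R : realType}.
Local Open Scope ereal_scope.
Local Open Scope charge_scope.

(* \int log(dQ/dP) dQ if Q << P, +oo otherwise; the negative part of the
   integrand is Q-integrable, so the integral is always well defined. *)
Definition KL d (T : measurableType d) (Q P : probability T R) : \bar R :=
  if `[< Q `<< P >] then
    \int[Q]_x (ln (fine (('d (charge_of_finite_measure Q) '/d P) x)))%:E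
  else +oo.

Definition supported11 (P : probability (Rmeas R) R) : Prop :=
  P `[(-1)%R, 1%R]%classic = 1.

(* A product measure on [-1, 1]^p is given by its factors, which it determines;
   [prod_prob Q] minimizes KL(. | nu) among these measures. *)
Definition mean_field_approx p (nu : probability (p.-tuple (Rmeas R)) R)
    (Q : 'I_p -> probability (Rmeas R) R) : Prop :=
  (forall i, supported11 (Q i)) /\
  forall Q' : 'I_p -> probability (Rmeas R) R,
    (forall i, supported11 (Q' i)) ->
    KL (prod_prob Q) nu <= KL (prod_prob Q') nu.

Definition mean_vector p (P : probability (p.-tuple (Rmeas R)) R) : 'cV[R]_p :=
  \col_i fine 'E_P[fun b => tnth b i : R].

Definition post_mean p (nu : probability (p.-tuple (Rmeas R)) R)
    (q : 'cV[R]_p) : R :=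
  fine 'E_nu[fun b => dotv q (vec b)].

End MeanField.

(* Main.v *)
(* Write m_i = sum_j A_ij beta_j for the local field at i and b_i for the
   conditional posterior mean of beta_i as a function of m_i: the mean of the
   prior tilted by exp((c_i + t) z - d_i z^2 / 2).  Its derivative is a variance
   in [0, 1] and its second derivative is bounded.

   Comparing the product minimizer of KL with the measure whose i-th factor is
   the tilt at t = s_i = sum_j A_ij u_j shows that this factor is that tilt, by
   the equality case of Gibbs' inequality; hence u_i = b_i(s_i).

   The residuals e_j = beta_j - b_j(m_j) are conditionally centred.  In
   E F^4 = sum_j a_j E[e_j F^3], where F = sum_j a_j e_j, one may therefore
   subtract from F^3 its value with beta_j frozen; a second order expansion shows
   that these increments of F are bounded in l2 by a multiple of |a|, pointwise,
   so that E F^4 <= C |a|^4.  With a the i-th row of A and the l4 contraction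
   m - s = A e + A (b(m) - b(s)) this gives sum_i E (m_i - s_i)^4 <= C p alpha^2.

   Finally w = E beta - u satisfies w = diag(b'(s)) A w + r with
   r_i = O(E (m_i - s_i)^2), and |A|_{2 -> 2} <= |A|_{4 -> 4} <= rho because A is
   symmetric; so |w|^2 <= C p alpha^2. *)
From HB Require Import structures.
Require Import Defs.
From mathcomp Require Import all_boot all_order all_algebra.
From mathcomp Require Import all_classical all_reals all_analysis.
From mathcomp Require Import measurable_realfun ring lra.

Set Implicit Arguments.
Unset Strict Implicit.
Unset Printing Implicit Defensive.

Import Order.TTheory GRing.Theory Num.Theory.
Import numFieldNormedType.Exports.

Local Open Scope classical_set_scope.
Local Open Scope ring_scope.

(** * Bounded functions and densities *)

Section BoundedMeasurable.
Context d (T : measurableType d) (R : realType).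
Implicit Types (f g : T -> R) (P : probability T R).

(** The linear Taylor term of the conditional means reproduces [A w], so the error [w] is driven
    only by squares of the fluctuations [m_i - s_i]. Squaring this source and summing over [i]
    produces fourth moments, and an l4 contraction closes an estimate for exactly these. On average
    a fluctuation has order [sqrt alpha], hence a source has order [alpha], and [p] of them give
    [p alpha^2]. The constant may depend on [rho] alone, so every estimate on conditional means must
    be uniform in the prior, in [d] and in [c]. This works because a tilt of a law on [-1, 1] has
    mean in [-1, 1], variance at most 1 and a quadratic Taylor error with a numerical constant.
    Nearly all integrands are kept bounded at every point, which makes integration linear with no
    integrability side conditions. The exception is the logarithm of the unknown factor densities of
    the minimizer: there integrability has to be extracted from finiteness of KL before common terms
    of two divergences may be cancelled. *)

Definition bounded_measurable f :=
  measurable_fun setT f /\ exists M : R, forall x, `|f x| <= M.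

Lemma bm_measurable f : bounded_measurable f -> measurable_fun setT f.
Proof. by case. Qed.

Lemma bm_cst c : bounded_measurable (fun=> c).
Proof. by split => //; exists `|c|. Qed.

Lemma bmD f g : bounded_measurable f -> bounded_measurable g ->
  bounded_measurable (fun x => f x + g x).
Proof.
move=> [mf [M fM]] [mg [N gN]]; split; first exact: measurable_funD.
by exists (M + N) => x; rewrite (le_trans (ler_normD _ _))// lerD.
Qed.

Lemma bmM f g : bounded_measurable f -> bounded_measurable g ->
  bounded_measurable (fun x => f x * g x).
Proof.
move=> [mf [M fM]] [mg [N gN]]; split; first exact: measurable_funM.
by exists (M * N) => x; rewrite normrM ler_pM.
Qed.

Lemma bmN f : bounded_measurable f -> bounded_measurable (fun x => - f x).
Proof.
move=> [mf [M fM]]; split; first exact: measurable_funN.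
by exists M => x; rewrite normrN.
Qed.

Lemma bmB f g : bounded_measurable f -> bounded_measurable g ->
  bounded_measurable (fun x => f x - g x).
Proof. by move=> bf bg; apply: bmD => //; exact: bmN. Qed.

Lemma bmX f n : bounded_measurable f -> bounded_measurable (fun x => f x ^+ n).
Proof.
move=> bf; elim: n => [|n IH]; first exact: bm_cst.
rewrite (_ : (fun x => _) = fun x => f x * f x ^+ n); first exact: bmM.
by apply/funext => x; rewrite exprS.
Qed.

Lemma bm_sum (I : Type) (s : seq I) (p : pred I) (h : I -> T -> R) :
  (forall i, bounded_measurable (h i)) ->
  bounded_measurable (fun x => \sum_(i <- s | p i) h i x).
Proof.
move=> bh; elim: s => [|i s IH].
  rewrite (_ : (fun x => _) = fun=> 0); first exact: bm_cst.
  by apply/funext => x; rewrite big_nil.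
rewrite (_ : (fun x => _) = fun x => (if p i then h i x else 0) +
    \sum_(i <- s | p i) h i x).
  by apply: bmD => //; case: (p i) => //; exact: bm_cst.
by apply/funext => x; rewrite big_cons; case: ifP => // _; rewrite add0r.
Qed.

Lemma bm_expR f : bounded_measurable f -> bounded_measurable (fun x => expR (f x)).
Proof.
move=> [mf [M fM]]; split; first exact: measurableT_comp.
exists (expR M) => x; rewrite ger0_norm ?expR_ge0// ler_expR.
by rewrite (le_trans (ler_norm _)).
Qed.

Lemma bm_integrable P f : bounded_measurable f -> P.-integrable setT (EFin \o f).
Proof.
move=> [mf [M fM]]; apply: measurable_bounded_integrable => //.
  by apply: (le_lt_trans (probability_le1 _ _)) => //; rewrite ltry.
exists M; split; first exact: num_real.
by move=> N MN x _; exact: (le_trans (fM x) (ltW MN)).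
Qed.

Lemma bm_EFin P f : bounded_measurable f ->
  (\int[P]_x (f x)%:E)%E = (\int[P]_x f x)%:E.
Proof.
by move=> bf; rewrite /Rintegral fineK//; exact: integrable_fin_num (bm_integrable P bf).
Qed.

Lemma bm_intD P f g : bounded_measurable f -> bounded_measurable g ->
  \int[P]_x (f x + g x) = \int[P]_x f x + \int[P]_x g x.
Proof. by move=> bf bg; rewrite RintegralD//; exact: bm_integrable. Qed.

Lemma bm_intB P f g : bounded_measurable f -> bounded_measurable g ->
  \int[P]_x (f x - g x) = \int[P]_x f x - \int[P]_x g x.
Proof. by move=> bf bg; rewrite RintegralB//; exact: bm_integrable. Qed.

Lemma bm_intZ P f c : bounded_measurable f ->
  \int[P]_x (c * f x) = c * \int[P]_x f x.
Proof. by move=> bf; rewrite RintegralZl//; exact: bm_integrable. Qed.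

Lemma int_cst P c : \int[P]_x c = c.
Proof. by rewrite Rintegral_cst//= (@probability_setT _ _ _ P) mulr1. Qed.

Lemma bm_int_le P f g : bounded_measurable f -> bounded_measurable g ->
  (forall x, f x <= g x) -> \int[P]_x f x <= \int[P]_x g x.
Proof. by move=> bf bg fg; apply: le_Rintegral => //; exact: bm_integrable. Qed.

Lemma bm_int_sum P (I : Type) (s : seq I) (p : pred I) (h : I -> T -> R) :
  (forall i, bounded_measurable (h i)) ->
  \int[P]_x (\sum_(i <- s | p i) h i x) = \sum_(i <- s | p i) \int[P]_x h i x.
Proof.
move=> bh; elim: s => [|i s IH].
  rewrite big_nil -[RHS](int_cst P 0); apply: eq_Rintegral => x _.
  by rewrite big_nil.
rewrite big_cons; case: ifP => pi.
  rewrite -IH -bm_intD//; last exact: bm_sum.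
  by apply: eq_Rintegral => x _; rewrite big_cons pi.
by rewrite -IH; apply: eq_Rintegral => x _; rewrite big_cons pi.
Qed.

Lemma int_ge0 P f : (forall x, 0 <= f x) -> 0 <= \int[P]_x f x.
Proof. by move=> f0; apply: Rintegral_ge0. Qed.

Lemma bm_int_sqr P f : bounded_measurable f ->
  (\int[P]_x f x) ^+ 2 <= \int[P]_x (f x ^+ 2).
Proof.
move=> bf; set m := \int[P]_x f x.
have : 0 <= \int[P]_x ((f x - m) ^+ 2) by apply: int_ge0 => x; exact: sqr_ge0.
rewrite (_ : (fun x => _) = fun x => (f x ^+ 2 - (2 * m) * f x) + m ^+ 2).
  rewrite bm_intD ?bm_intB ?bm_intZ ?int_cst; first by rewrite -/m; nra.
  all: repeat (apply: bmB || apply: bmM || apply: bmX || apply: bm_cst || done).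
by apply/funext => x; ring.
Qed.

Lemma bm_int_norm P f M : bounded_measurable f -> (forall x, `|f x| <= M) ->
  `|\int[P]_x f x| <= M.
Proof.
move=> bf fM; rewrite ler_norml -(int_cst P (- M)) -[X in _ && (_ <= X)](int_cst P M).
by apply/andP; split; apply: bm_int_le => //; try exact: bm_cst;
  move=> x; have := fM x; rewrite ler_norml => /andP[].
Qed.

Lemma bm_int_ae P f g : bounded_measurable f -> measurable_fun setT g ->
  {ae P, forall x, f x = g x} -> (\int[P]_x (g x)%:E)%E = (\int[P]_x f x)%:E.
Proof.
move=> bf mg fg; rewrite -bm_EFin//; apply: ae_eq_integral => //.
- exact/measurable_EFinP.
- by apply/measurable_EFinP; exact: bm_measurable.
- by apply: filterS fg => x /= ->.
Qed.

End BoundedMeasurable.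

(** * Probability measures given by densities, and change of measure *)

Section Density.
Context d (T : measurableType d) (R : realType).
Implicit Types (nu mu : probability T R) (f g : T -> R).
Local Open Scope ereal_scope.

(** A pointwise finite and nonnegative version of the Radon-Nikodym derivative, which can be
    multiplied and composed like any real function. *)
Definition density_of nu mu f := [/\ measurable_fun setT f,
  (forall x, 0 <= f x)%R &
  forall A, measurable A -> nu A = \int[mu]_(x in A) (f x)%:E].

Lemma density_dominates nu mu f : density_of nu mu f -> nu `<< mu.
Proof.
move=> [mf f0 nuE]; apply/null_content_dominatesP => A mA muA.
rewrite nuE//; apply: null_set_integral => //.
by apply/measurable_EFinP; exact: measurable_funTS.
Qed.

Lemma density_integrable nu mu f : density_of nu mu f ->
  mu.-integrable setT (EFin \o f).
Proof.
move=> [mf f0 nuE]; apply/integrableP; split; first exact/measurable_EFinP.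
under eq_integral do rewrite /= ger0_norm//.
by rewrite -nuE// probability_setT ltry.
Qed.

Lemma density_RN nu mu f : density_of nu mu f ->
  ae_eq mu setT (EFin \o f)
    (Radon_Nikodym (charge_of_finite_measure nu) mu).
Proof.
move=> df; have numu := density_dominates df.
have [mf f0 nuE] := df; apply: integral_ae_eq => //.
  exact: density_integrable df.
by move=> E _ mE; rewrite -nuE// -Radon_Nikodym_integral.
Qed.

Lemma density_exists nu mu : nu `<< mu -> exists f, density_of nu mu f.
Proof.
move=> numu; have [f [f0 ffin fint fE]] :=
  radon_nikodym_sigma_finite (nu := nu) (mu := mu) numu.
exists (fine \o f); split.
- by apply: measurableT_comp => //; exact: measurable_int fint.
- by move=> x /=; exact: fine_ge0.
- by move=> A mA; rewrite fE//; apply: eq_integral => x _; rewrite /= fineK.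
Qed.

Lemma density_integral nu mu f (phi : T -> \bar R) : density_of nu mu f ->
  measurable_fun setT phi -> (forall x, 0 <= phi x) ->
  \int[nu]_x phi x = \int[mu]_x (phi x * (f x)%:E).
Proof.
move=> df mphi phi0; have numu := density_dominates df.
have [mf f0 nuE] := df.
rewrite -(Radon_Nikodym_SigmaFinite.change_of_variables numu)//.
have mRN : measurable_fun setT (Radon_Nikodym_SigmaFinite.f nu mu).
  exact: measurable_int (Radon_Nikodym_SigmaFinite.f_integrable numu).
apply: ae_eq_integral => //.
- exact: emeasurable_funM.
- by apply: emeasurable_funM => //; exact/measurable_EFinP.
- apply: ae_eqe_mul2l; apply: integral_ae_eq => //.
  + exact: Radon_Nikodym_SigmaFinite.f_integrable.
  + exact/measurable_EFinP.
  + by move=> E _ mE; rewrite -nuE// -Radon_Nikodym_SigmaFinite.f_integral.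
Qed.

Lemma density_intro nu mu f : measurable_fun setT f -> (forall x, 0 <= f x)%R ->
  (forall phi : T -> \bar R, measurable_fun setT phi -> (forall x, 0 <= phi x) ->
    \int[nu]_x phi x = \int[mu]_x (phi x * (f x)%:E)) ->
  density_of nu mu f.
Proof.
move=> mf f0 h; split => // A mA.
have := h (EFin \o \1_A); rewrite integral_indic// setIT => ->; last 2 first.
- by apply/measurable_EFinP.
- by move=> x; rewrite lee_fin.
rewrite [RHS]integral_mkcond; apply: eq_integral => x _ /=.
rewrite patchE indicE; case: ifPn => xA; last by rewrite mul0e.
by rewrite mul1e.
Qed.

(** The zero set of [f] carries no [nu]-mass. Logarithms of densities can therefore be split under
    [nu], away from the default value of [ln] at 0. *)
Lemma density_ae_gt0 nu mu f : density_of nu mu f -> {ae nu, forall x, (0 < f x)%R}.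
Proof.
move=> [mf f0 nuE].
have m0 : measurable (f @^-1` [set 0%R]) by rewrite -[X in measurable X]setTI; exact: mf.
exists (f @^-1` [set 0%R]); split => //.
  rewrite nuE//; apply: integral0_eq => x /= -> //.
by move=> x /=; rewrite lt0r f0 andbT => /negP; rewrite negbK => /eqP.
Qed.

(** Adding the bound [M] makes [phi] nonnegative, where the change of measure is available; the
    shift cancels because [f] integrates to 1. *)
Lemma bm_density_integral nu mu f (phi : T -> R) : density_of nu mu f ->
  bounded_measurable f -> bounded_measurable phi ->
  (\int[nu]_x phi x = \int[mu]_x (phi x * f x))%R.
Proof.
move=> df bf bphi; have [mphi [M phiM]] := bphi.
have key (g : T -> R) : bounded_measurable g -> (forall x, 0 <= g x)%R ->
    (\int[nu]_x g x = \int[mu]_x (g x * f x))%R.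
  move=> bg g0; rewrite /Rintegral (density_integral df)//.
    by apply/measurable_EFinP; exact: bm_measurable.
have bM := @bm_cst _ T R M.
have := key (fun x => phi x + M)%R (bmD bphi bM).
rewrite bm_intD// int_cst => H; apply: (addIr M); rewrite {}H; last first.
  by move=> x; have := phiM x; rewrite ler_norml => /andP[+ _]; rewrite -subr_ge0 opprK.
have f1 : (\int[mu]_x f x = 1)%R.
  have := key (fun=> 1%R) (@bm_cst _ _ _ _) (fun=> ler01).
  by rewrite int_cst => ->; apply: eq_Rintegral => x _; rewrite mul1r.
have -> : (\int[mu]_x ((phi x + M) * f x) = \int[mu]_x (phi x * f x) + M)%R.
  under eq_Rintegral do rewrite mulrDl.
  by rewrite bm_intD ?bm_intZ ?f1 ?mulr1//; exact: bmM.
by [].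
Qed.

End Density.

(** * Product measures *)

Section ProductMeasure.
Context {R : realType}.
Implicit Types p : nat.

Definition upd p (i : 'I_p) (b : p.-tuple (Rmeas R)) (z : Rmeas R) :
  p.-tuple (Rmeas R) := [tuple if j == i then z else tnth b j | j < p].

Lemma tnth_upd p (i j : 'I_p) b z :
  tnth (upd i b z) j = if j == i then z else tnth b j.
Proof. by rewrite tnth_mktuple. Qed.

Lemma upd_upd p (i : 'I_p) b z z' : upd i (upd i b z) z' = upd i b z'.
Proof. by apply: eq_from_tnth => j; rewrite !tnth_upd; case: (j == i). Qed.

Lemma measurable_upd p (i : 'I_p) :
  measurable_fun setT (fun w : p.-tuple (Rmeas R) * Rmeas R => upd i w.1 w.2).
Proof.
apply/measurable_fun_tnthP => j.
have [->|ji] := eqVneq j i.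
  rewrite (_ : _ \o _ = snd) //; apply/funext => w /=.
  by rewrite tnth_upd eqxx.
rewrite (_ : _ \o _ = (fun b => tnth b j) \o fst).
  by apply: measurableT_comp => //; exact: measurable_tnth.
by apply/funext => w /=; rewrite tnth_upd (negbTE ji).
Qed.

Lemma measurable_updl p (i : 'I_p) z :
  measurable_fun setT (fun b : p.-tuple (Rmeas R) => upd i b z).
Proof.
apply: (measurableT_comp (measurable_upd i) (g := fun b => (b, z))) => //.
Qed.

Lemma measurable_updr p (i : 'I_p) b :
  measurable_fun setT (fun z : Rmeas R => upd i b z).
Proof.
apply: (measurableT_comp (measurable_upd i) (g := fun z => (b, z))) => //.
exact: pair1_measurable.
Qed.

Lemma upd0_cons p (w : Rmeas R * p.-tuple (Rmeas R)) z :
  upd ord0 (consT w) z = consT (z, w.2).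
Proof.
apply: eq_from_tnth => j; rewrite tnth_upd.
case: (unliftP ord0 j) => [k ->|->].
  by rewrite eq_sym (negbTE (neq_lift _ _)) !tnthS.
by rewrite eqxx !tnth0.
Qed.

Lemma updS_cons p (i : 'I_p) (w : Rmeas R * p.-tuple (Rmeas R)) z :
  upd (lift ord0 i) (consT w) z = consT (w.1, upd i w.2 z).
Proof.
apply: eq_from_tnth => j; rewrite tnth_upd.
case: (unliftP ord0 j) => [k ->|->].
  by rewrite (inj_eq lift_inj) !tnthS tnth_upd.
by rewrite (negbTE (neq_lift _ _)) !tnth0.
Qed.

Local Open Scope ereal_scope.

Lemma integral_prod_probS p (P : 'I_p.+1 -> probability (Rmeas R) R)
    (phi : p.+1.-tuple (Rmeas R) -> \bar R) :
  measurable_fun setT phi -> (forall b, 0 <= phi b) ->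
  \int[prod_prob P]_b phi b =
  \int[P ord0]_z \int[prod_prob (fun i => P (lift ord0 i))]_b phi (consT (z, b)).
Proof.
move=> mphi phi0; rewrite ge0_integral_distribution//.
rewrite (fubini_tonelli1 (phi \o @consT R p))//; last by move=> x; exact: phi0.
apply: measurableT_comp => //; exact: measurable_consT.
Qed.

Lemma measurable_int_consT p (P : probability (p.-tuple (Rmeas R)) R)
    (phi : p.+1.-tuple (Rmeas R) -> \bar R) :
  measurable_fun setT phi -> (forall b, 0 <= phi b) ->
  measurable_fun setT (fun z => \int[P]_b phi (consT (z, b))).
Proof.
move=> mphi phi0.
apply: (measurable_fun_fubini_tonelli_F (phi \o @consT R p)) => //; last by move=> x; exact: phi0.
apply: measurableT_comp => //; exact: measurable_consT.
Qed.

Lemma measurable_int_upd p (i : 'I_p) (P : probability (Rmeas R) R)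
    (phi : p.-tuple (Rmeas R) -> \bar R) :
  measurable_fun setT phi -> (forall b, 0 <= phi b) ->
  measurable_fun setT (fun b => \int[P]_z phi (upd i b z)).
Proof.
move=> mphi phi0.
apply: (measurable_fun_fubini_tonelli_F
  (fun w : p.-tuple (Rmeas R) * Rmeas R => phi (upd i w.1 w.2))) => //.
apply: measurableT_comp => //; exact: measurable_upd.
Qed.

(** Fubini with coordinate [i] innermost. As [upd] overwrites that coordinate, [P i] may be
    arbitrary. With [P' = P] this exposes the conditional law of one coordinate; with a different
    [P' i] it compares two products that differ in one factor. *)
Lemma integral_resample p (P P' : 'I_p -> probability (Rmeas R) R) (i : 'I_p)
    (phi : p.-tuple (Rmeas R) -> \bar R) :
  (forall j, j != i -> P' j = P j) ->
  measurable_fun setT phi -> (forall b, 0 <= phi b) ->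
  \int[prod_prob P']_b phi b =
  \int[prod_prob P]_b \int[P' i]_z phi (upd i b z).
Proof.
elim: p P P' i phi => [|p IH] P P' i phi PP' mphi phi0; first by have := ltn_ord i.
rewrite integral_prod_probS// [RHS]integral_prod_probS//; last 2 first.
- exact: measurable_int_upd.
- by move=> b; exact: integral_ge0.
case: (unliftP ord0 i) PP' => [k ->|->] PP'.
  rewrite PP'//; apply: eq_integral => z _.
  rewrite (IH (fun i => P (lift ord0 i)) _ k)//.
  - apply: eq_integral => b _; apply: eq_integral => z' _.
    by rewrite updS_cons.
  - by move=> j jk; rewrite PP'// (inj_eq lift_inj).
  - apply: measurableT_comp => //.
    apply: (measurableT_comp (measurable_consT (p := p)) (g := fun b => (z, b))) => //.
    exact: pair1_measurable.
(* When [i] is the first coordinate, the outer draw [z0] is overwritten and integrates out with mass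
   1; Tonelli swaps the two remaining integrals. *)
transitivity (\int[P ord0]_z0 \int[prod_prob (fun i => P (lift ord0 i))]_b
   \int[P' ord0]_z phi (consT (z, b))); last first.
  apply: eq_integral => z _; apply: eq_integral => b _.
  by apply: eq_integral => z' _; rewrite upd0_cons.
rewrite integral_cst//= (@probability_setT _ _ _ (P ord0)) mule1.
have -> : (fun j => P' (lift ord0 j)) = (fun j => P (lift ord0 j)).
  by apply/funext => j; rewrite PP'.
rewrite (fubini_tonelli (phi \o @consT R p))//; last by move=> x; exact: phi0.
apply: measurableT_comp => //; exact: measurable_consT.
Qed.

Lemma integral_marginal p (P : 'I_p -> probability (Rmeas R) R) (i : 'I_p)
    (g : Rmeas R -> \bar R) : measurable_fun setT g -> (forall z, 0 <= g z) ->
  \int[prod_prob P]_b g (tnth b i) = \int[P i]_z g z.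
Proof.
move=> mg g0; rewrite (@integral_resample _ P P i)//.
  transitivity (\int[prod_prob P]_b \int[P i]_z g z).
    by apply: eq_integral => b _; apply: eq_integral => z _; rewrite tnth_upd eqxx.
  by rewrite integral_cst//= (@probability_setT _ _ _ (prod_prob P)) mule1.
by apply: measurableT_comp => //; exact: measurable_tnth.
Qed.

Lemma prod_prob_marginal p (P : 'I_p -> probability (Rmeas R) R) (i : 'I_p) A :
  measurable A -> prod_prob P [set b | A (tnth b i)] = P i A.
Proof.
move=> mA.
have mA' : measurable [set b : p.-tuple (Rmeas R) | A (tnth b i)].
  rewrite -[X in measurable X]setTI; apply: (@measurable_tnth _ _ _ i) => //.
transitivity (\int[P i]_z (EFin \o \1_A) z); last by rewrite integral_indic// setIT.
rewrite -(@integral_marginal _ P i (EFin \o \1_A))//; last 2 first.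
- by apply/measurable_EFinP.
- by move=> z; rewrite lee_fin.
rewrite (_ : (fun b => _) = EFin \o \1_[set b | A (tnth b i)]) ?integral_indic ?setIT//.
Qed.

Lemma prod_prob_ae_marginal p (P : 'I_p -> probability (Rmeas R) R) (i : 'I_p)
    (A : set R) : {ae P i, forall z, A z} ->
  {ae prod_prob P, forall b, A (tnth b i)}.
Proof.
move=> [N [mN N0 AN]]; exists [set b | N (tnth b i)]; split.
- rewrite -[X in measurable X]setTI; exact: (@measurable_tnth _ _ _ i).
- by rewrite prod_prob_marginal.
- by move=> b /= Ab; apply: AN.
Qed.

Lemma ae_forall_ord d (T : measurableType d) (mu : probability T R) p
  (A : 'I_p -> T -> Prop) : (forall i, {ae mu, forall x, A i x}) ->
  {ae mu, forall x, forall i, A i x}.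
Proof. by move=> h; apply: filter_forall. Qed.

(** The identity is proved against nonnegative test functions rather than sets, because the
    induction on [p] passes to the sections [phi (consT (z, b))]. *)
Lemma density_prod_prob p (Q P : 'I_p -> probability (Rmeas R) R) (f : 'I_p -> R -> R) :
  (forall i, density_of (Q i) (P i) (f i)) ->
  density_of (prod_prob Q) (prod_prob P) (fun b => \prod_i f i (tnth b i))%R.
Proof.
move=> df; apply: density_intro.
- apply: measurable_prod => i _; apply: measurableT_comp => //; last exact: measurable_tnth.
  by case: (df i).
- by move=> b; apply: prodr_ge0 => i _; case: (df i).
elim: p Q P f df => [|p IH] Q P f df phi mphi phi0.
  by apply: eq_integral => b _; rewrite big_ord0 mule1.
have mf i : measurable_fun setT (f i) by case: (df i).
have f0 i x : (0 <= f i x)%R by case: (df i).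
have mprod q (h : 'I_q -> R -> R) : (forall i, measurable_fun setT (h i)) ->
    measurable_fun setT (fun b : q.-tuple (Rmeas R) => \prod_i h i (tnth b i))%R.
  move=> mh; apply: measurable_prod => i _.
  exact: (measurableT_comp (mh i) (measurable_tnth i)).
rewrite integral_prod_probS// [RHS]integral_prod_probS//; last 2 first.
- apply: emeasurable_funM => //; apply/measurable_EFinP; exact: (mprod _ f mf).
- by move=> b; rewrite mule_ge0// lee_fin prodr_ge0.
rewrite (density_integral (df ord0)); last 2 first.
- exact: measurable_int_consT.
- by move=> z; exact: integral_ge0.
apply: eq_integral => z _.
have mz : measurable_fun setT (fun b => phi (consT (z, b))).
  apply: measurableT_comp => //.
  apply: (measurableT_comp (measurable_consT (p := p)) (g := fun b => (z, b))) => //.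
  exact: pair1_measurable.
rewrite (IH _ (fun i => P (lift ord0 i)) (fun i => f (lift ord0 i)))//.
rewrite muleC -ge0_integralZl//; last 3 first.
- apply: emeasurable_funM => //; apply/measurable_EFinP.
  exact: (mprod _ (fun i => f (lift ord0 i))).
- by move=> b _; rewrite mule_ge0// lee_fin prodr_ge0.
- by rewrite lee_fin.
apply: eq_integral => b _; rewrite big_ord_recl tnth0 EFinM muleCA.
by under [in RHS]eq_bigr do rewrite tnthS.
Qed.

End ProductMeasure.

Section ProductMeasureBounded.
Context {R : realType}.
Variables (p : nat).
Local Notation T := (p.-tuple (Rmeas R)).

Lemma bm_updr (phi : T -> R) i b : bounded_measurable phi ->
  bounded_measurable (fun z => phi (upd i b z)).
Proof.
move=> [mphi [M phiM]]; split; last by exists M.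
by apply: measurableT_comp => //; exact: measurable_updr.
Qed.

Lemma bm_int_resample (P P' : 'I_p -> probability (Rmeas R) R) (i : 'I_p)
    (phi : T -> R) :
  (forall j, j != i -> P' j = P j) -> bounded_measurable phi ->
  \int[prod_prob P']_b phi b =
  \int[prod_prob P]_b \int[P' i]_z phi (upd i b z).
Proof.
move=> PP' bphi; have [mphi [M phiM]] := bphi.
have bM d' (T' : measurableType d') := @bm_cst _ T' R M.
have phi0 b : 0 <= phi b + M.
  by have := phiM b; rewrite ler_norml => /andP[+ _]; rewrite -subr_ge0 opprK.
have minner : bounded_measurable (fun b => \int[P' i]_z phi (upd i b z)).
  split; last first.
    by exists M => b; apply: bm_int_norm => //; exact: bm_updr.
  rewrite (_ : (fun b => _) = fun b =>
      fine (\int[P' i]_z ((phi (upd i b z) + M)%R)%:E)%E - M); last first.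
    apply/funext => b; rewrite -[fine _]/(\int[P' i]_z (phi (upd i b z) + M)).
    by rewrite bm_intD ?int_cst ?addrK//; exact: bm_updr.
  apply: measurable_funB => //; apply: measurableT_comp => //.
  apply: (@measurable_int_upd _ _ i (P' i) (fun b => (phi b + M)%:E)) => //.
  by apply/measurable_EFinP; exact: measurable_funD.
apply: (addIr M).
rewrite -{1}(int_cst (prod_prob P') M) -bm_intD//.
rewrite -[X in _ = _ + X](int_cst (prod_prob P) M) -bm_intD//.
rewrite {1}/Rintegral (integral_resample PP')//; last first.
  by apply/measurable_EFinP; exact: measurable_funD.
congr fine; apply: eq_integral => b _.
rewrite bm_EFin; last by apply: bmD => //; exact: bm_updr.
by rewrite bm_intD ?int_cst//; exact: bm_updr.
Qed.

Lemma bm_int_marginal (P : 'I_p -> probability (Rmeas R) R) (i : 'I_p)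
    (g : R -> R) : @bounded_measurable _ (Rmeas R) R g ->
  \int[prod_prob P]_b g (tnth b i) = \int[P i]_z g z.
Proof.
move=> bg; rewrite (@bm_int_resample P P i (fun b => g (tnth b i)))//.
  rewrite -[RHS](int_cst (prod_prob P)); apply: eq_Rintegral => b _.
  by apply: eq_Rintegral => z _; rewrite tnth_upd eqxx.
case: bg => mg [M gM]; split; last by exists M.
by apply: measurableT_comp => //; exact: measurable_tnth.
Qed.

End ProductMeasureBounded.

(** * Tilted priors *)

Section Clip.
Context {R : realType}.

(* The measures of interest live on [-1, 1]^p; clipping the coordinates makes
   every function of them bounded everywhere without changing it a.e. *)
Definition clip (z : R) : R := Num.max (-1) (Num.min 1 z).

Lemma clip_bounds z : -1 <= clip z <= 1.
Proof. by rewrite /clip le_max lexx /= ge_max ge_min lexx /=; lra. Qed.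

Lemma clip_norm z : `|clip z| <= 1.
Proof. by rewrite ler_norml clip_bounds. Qed.

Lemma clip_id z : -1 <= z <= 1 -> clip z = z.
Proof. by move=> /andP[z0 z1]; rewrite /clip (min_idPr z1) (max_idPr z0). Qed.

Lemma bm_clip : @bounded_measurable _ (Rmeas R) R clip.
Proof.
split; last by exists 1 => z; exact: clip_norm.
by apply: measurable_maxr => //; apply: measurable_minr.
Qed.

End Clip.

Section Elementary.
Context {R : realType}.

(** The lower bound [1 - t <= expR (- t)] gives [expR t <= 1 / (1 - t)], and
    [1 / (1 - t) <= 1 + t + 2 t^2] for these [t]. *)
Lemma expR_quadratic (t : R) : `|t| <= 2^-1 -> `|expR t - 1 - t| <= 2 * t ^+ 2.
Proof.
move=> t2; have := t2; rewrite ler_norml => /andP[ta tb].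
have h1 : 1 + t <= expR t by exact: expR_ge1Dx.
have h2 : 1 - t <= expR (- t) by exact: expR_ge1Dx.
have h3 : expR t * expR (- t) = 1 by rewrite -expRD subrr expR0.
have h4 : expR t * (1 - t) <= 1 by rewrite -[leRHS]h3 ler_pM2l ?expR_gt0.
rewrite ger0_norm; last by rewrite subr_ge0 lerBrDl.
have t20 := sqr_ge0 t.
have : expR t * (1 - t) <= (1 + t + 2 * t ^+ 2) * (1 - t).
  rewrite (le_trans h4)// (_ : _ * _ = 1 + t ^+ 2 * (1 - 2 * t)); last by ring.
  by rewrite lerDl mulr_ge0//; lra.
rewrite ler_pM2r; lra.
Qed.

Lemma lipschitz_of_taylor (b D : R -> R) C :
  (forall x, 0 <= D x <= 1) -> 0 <= C ->
  (forall x h, `|b (x + h) - b x - D x * h| <= C * h ^+ 2) ->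
  forall x h, `|b (x + h) - b x| <= `|h|.
Proof.
move=> D01 C0 taylor x h.
have step (n : nat) y k : `|b (y + n%:R * k) - b y| <= n%:R * (`|k| + C * k ^+ 2).
  elim: n => [|n IH]; first by rewrite !mul0r addr0 subrr normr0.
  have -> : b (y + n.+1%:R * k) - b y =
     (b (y + n%:R * k + k) - b (y + n%:R * k)) + (b (y + n%:R * k) - b y).
    have -> : y + n.+1%:R * k = y + n%:R * k + k by rewrite -natr1; ring.
    ring.
  rewrite (le_trans (ler_normD _ _))// -natr1 mulrDl mul1r addrC lerD//.
  set u := y + n%:R * k.
  rewrite (_ : b (u + k) - b u = (b (u + k) - b u - D u * k) + D u * k); last by ring.
  rewrite (le_trans (ler_normD _ _))// addrC lerD// normrM ger0_norm; last by case/andP: (D01 u).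
  by rewrite ler_piMl//; case/andP: (D01 u).
apply/ler_addgt0Pl => e e0.
pose n := (Num.truncn (C * h ^+ 2 / e)).+1.
have n0 : 0 < n%:R :> R by rewrite ltr0n.
have hn : C * h ^+ 2 / e < n%:R by apply: truncnS_gt.
have := step n x (h / n%:R).
rewrite (_ : n%:R * (h / n%:R) = h); last by rewrite mulrCA divff ?mulr1// gt_eqF.
move=> /le_trans; apply.
rewrite mulrDr normrM [`|n%:R^-1|]gtr0_norm ?invr_gt0//.
rewrite (_ : n%:R * (`|h| / n%:R) = `|h|); last by rewrite mulrCA divff ?mulr1// gt_eqF.
rewrite addrC lerD2r.
rewrite (_ : n%:R * _ = C * h ^+ 2 / n%:R); last by field; rewrite gt_eqF.
by rewrite ler_pdivrMr// [e * _]mulrC -ler_pdivrMr// ltW.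
Qed.

End Elementary.

Section Tilt.
Context {R : realType}.
Variables (mu : probability (Rmeas R) R) (d : R).
Implicit Types (t h : R) (phi : R -> R).
Local Notation bm := (@bounded_measurable _ (Rmeas R) R).

(** On the support of the prior this is the density, up to normalization, of the quadratic tilt by
    [d] followed by the exponential tilt by [t]. Hence [tilt_mean] is the function psi' of the
    mean-field equations. *)
Definition tilt_weight t (z : R) := expR (t * clip z - d / 2 * clip z ^+ 2).

Definition tilt_mass t := \int[mu]_z tilt_weight t z.

Definition tilt_exp t phi := (\int[mu]_z (phi z * tilt_weight t z)) / tilt_mass t.

Definition tilt_mean t := tilt_exp t clip.

(** The variance of the tilted law, which is also the derivative of [tilt_mean] at [t]. *)
Definition tilt_var t := tilt_exp t (fun z => clip z ^+ 2) - tilt_mean t ^+ 2.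

Lemma bm_tilt_weight t : bm (tilt_weight t).
Proof.
apply: bm_expR; apply: bmB; apply: bmM; try exact: bm_cst; last apply: bmX;
  exact: bm_clip.
Qed.
Hint Resolve bm_tilt_weight bm_clip : core.

Lemma tilt_mass_gt0 t : 0 < tilt_mass t.
Proof.
have h z : expR (- (`|t| + `|d|)) <= tilt_weight t z.
  rewrite ler_expR; have := clip_norm z; have := sqr_ge0 (clip z).
  have -> : clip z ^+ 2 = `|clip z| ^+ 2 by rewrite real_normK ?num_real.
  move=> _ c1; rewrite opprD lerD//.
    rewrite lerNl (le_trans (ler_norm _))// normrN normrM.
    by rewrite ler_piMr.
  rewrite lerN2 (le_trans (ler_norm _))// normrM normrX normr_id normrM.
  rewrite [`|2^-1|]ger0_norm ?invr_ge0//.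
  rewrite -mulrA ler_piMr//.
  have : `|clip z| ^+ 2 <= 1 by rewrite exprn_ile1.
  by rewrite ?real_normK ?num_real//; lra.
apply: (@lt_le_trans _ _ (expR (- (`|t| + `|d|)))); first exact: expR_gt0.
rewrite -(int_cst mu (expR _)); apply: bm_int_le => //; exact: bm_cst.
Qed.

Lemma tilt_expD t phi psi : bm phi -> bm psi ->
  tilt_exp t (fun z => phi z + psi z) = tilt_exp t phi + tilt_exp t psi.
Proof.
move=> bphi bpsi; rewrite /tilt_exp -mulrDl -bm_intD; try exact: bmM.
by congr (_ / _); apply: eq_Rintegral => z _; rewrite mulrDl.
Qed.

Lemma tilt_expZ t c phi : bm phi ->
  tilt_exp t (fun z => c * phi z) = c * tilt_exp t phi.
Proof.
move=> bphi; rewrite /tilt_exp mulrA -bm_intZ; last exact: bmM.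
by congr (_ / _); apply: eq_Rintegral => z _; rewrite mulrA.
Qed.

Lemma tilt_exp_cst t c : tilt_exp t (fun=> c) = c.
Proof. by rewrite /tilt_exp bm_intZ// -/(tilt_mass t) mulfK// gt_eqF// tilt_mass_gt0. Qed.

Lemma tilt_exp_le t phi psi : bm phi -> bm psi ->
  (forall z, phi z <= psi z) -> tilt_exp t phi <= tilt_exp t psi.
Proof.
move=> bphi bpsi h; rewrite ler_pM2r ?invr_gt0 ?tilt_mass_gt0//.
apply: bm_int_le; try exact: bmM.
by move=> z; rewrite ler_pM2r ?expR_gt0.
Qed.

Lemma tilt_exp_norm t phi M : bm phi -> (forall z, `|phi z| <= M) ->
  `|tilt_exp t phi| <= M.
Proof.
move=> bphi h; rewrite ler_norml -{1}(tilt_exp_cst t (- M)) -{2}(tilt_exp_cst t M).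
by apply/andP; split; apply: tilt_exp_le => //; try exact: bm_cst;
  move=> z; have := h z; rewrite ler_norml => /andP[].
Qed.

Lemma tilt_mean_norm t : `|tilt_mean t| <= 1.
Proof. by apply: tilt_exp_norm => // z; exact: clip_norm. Qed.

Lemma tilt_var01 t : 0 <= tilt_var t <= 1.
Proof.
have b2 : bm (fun z => clip z ^+ 2) by exact: bmX.
apply/andP; split; last first.
  rewrite /tilt_var lerBlDr (@le_trans _ _ 1) ?lerDl ?sqr_ge0//.
  rewrite -[leRHS](tilt_exp_cst t); apply: tilt_exp_le => //; first exact: bm_cst.
  by move=> z; have /andP[] := clip_bounds z; nra.
have : 0 <= tilt_exp t (fun z => (clip z ^+ 2 + (- (2 * tilt_mean t)) * clip z) +
    tilt_mean t ^+ 2).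
  rewrite -[leLHS](tilt_exp_cst t); apply: tilt_exp_le; first exact: bm_cst.
    by apply: bmD; [apply: bmD => //; apply: bmM => //; exact: bm_cst | exact: bm_cst].
  move=> z; rewrite (_ : _ + _ = (clip z - tilt_mean t) ^+ 2) ?sqr_ge0//; ring.
rewrite tilt_expD; [|by apply: bmD => //; apply: bmM => //; exact: bm_cst|exact: bm_cst].
rewrite tilt_expD; [|by []|by apply: bmM => //; exact: bm_cst].
rewrite tilt_expZ// tilt_exp_cst -/(tilt_mean t) /tilt_var; nra.
Qed.

Lemma tilt_meanD t h : tilt_mean (t + h) =
  tilt_exp t (fun z => clip z * expR (h * clip z)) / tilt_exp t (fun z => expR (h * clip z)).
Proof.
have w z : tilt_weight (t + h) z = expR (h * clip z) * tilt_weight t z.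
  by rewrite /tilt_weight -expRD; congr expR; ring.
have -> : tilt_mean (t + h) = (\int[mu]_z (clip z * expR (h * clip z) * tilt_weight t z)) /
   (\int[mu]_z (expR (h * clip z) * tilt_weight t z)).
  by congr (_ / _); apply: eq_Rintegral => z _; rewrite w ?mulrA.
rewrite /tilt_exp invfM invrK mulrACA mulVf ?mulr1//.
by rewrite gt_eqF// tilt_mass_gt0.
Qed.

(** Passing from [t] to [t + h] reweights the tilted law by [expR (h * clip z)]. Expanding numerator
    and denominator of the new mean to second order gives a bound that depends on neither [mu], [d]
    nor [t]. *)
Lemma tilt_mean_taylor t h :
  `|tilt_mean (t + h) - tilt_mean t - tilt_var t * h| <= 12 * h ^+ 2.
Proof.
have /andP[v0 v1] := tilt_var01 t.
have := tilt_mean_norm t; rewrite ler_norml => /andP[m0 m1].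
(* For [|h| > 1/2] boundedness is enough: the left side is at most [2 + |h|], which is below
   [12 h^2]. *)
have [h2|h2] := leP `|h| (2^-1); last first.
  have hh : h ^+ 2 = `|h| ^+ 2 by rewrite real_normK ?num_real.
  have := tilt_mean_norm (t + h); rewrite ler_norml => /andP[n0 n1].
  have vh : `|tilt_var t * h| <= `|h| by rewrite normrM ger0_norm// ler_piMl.
  have : `|tilt_mean (t + h) - tilt_mean t| <= 2 by rewrite ler_norml; lra.
  move=> a2; rewrite (le_trans (ler_normB _ _))// hh.
  by nra.
have bexp : bm (fun z => expR (h * clip z)).
  by apply: bm_expR; apply: bmM => //; exact: bm_cst.
have rem z : `|expR (h * clip z) - 1 - h * clip z| <= 2 * h ^+ 2.
  have c1 := clip_norm z.
  have hc : `|h * clip z| <= `|h| by rewrite normrM ler_piMr.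
  rewrite (le_trans (expR_quadratic (le_trans hc h2)))// ler_pM2l//.
  by rewrite -(real_normK (num_real (h * _))) -(real_normK (num_real h)) lerXn2r ?nnegrE.
pose r z := expR (h * clip z) - 1 - h * clip z.
have br : bm r by apply: bmB; [apply: bmB => //|apply: bmM => //]; exact: bm_cst.
have r0 : `|tilt_exp t r| <= 2 * h ^+ 2 by exact: tilt_exp_norm.
have r1 : `|tilt_exp t (fun z => clip z * r z)| <= 2 * h ^+ 2.
  apply: tilt_exp_norm; first exact: bmM.
  by move=> z; rewrite normrM -[leRHS]mul1r; apply: ler_pM => //; [exact: clip_norm|exact: rem].
set v := tilt_var t in v0 v1 *; set m := tilt_mean t in m0 m1 *.
have eD : tilt_exp t (fun z => expR (h * clip z)) = 1 + h * m + tilt_exp t r.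
  rewrite -(tilt_exp_cst t 1) -tilt_expZ// -!tilt_expD//; try exact: bm_cst.
  - by congr tilt_exp; apply/funext => z; rewrite /r; ring.
  - by apply: bmD; [exact: bm_cst|apply: bmM => //; exact: bm_cst].
  - by apply: bmM => //; exact: bm_cst.
have eN : tilt_exp t (fun z => clip z * expR (h * clip z)) =
    m + h * (v + m ^+ 2) + tilt_exp t (fun z => clip z * r z).
  rewrite /v /tilt_var subrK -tilt_expZ; last exact: bmX.
  have b1 : bm (fun z => h * clip z ^+ 2) by apply: bmM; [exact: bm_cst|exact: bmX].
  have b2 : bm (fun z => clip z * r z) by exact: bmM.
  rewrite /m /tilt_mean -!tilt_expD//; last exact: bmD.
  by congr tilt_exp; apply/funext => z; rewrite /r; ring.
have D2 : 2^-1 <= tilt_exp t (fun z => expR (h * clip z)).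
  rewrite -(tilt_exp_cst t 2^-1); apply: tilt_exp_le => //; first exact: bm_cst.
  move=> z; apply: le_trans (expR_ge1Dx _).
  have : `|h * clip z| <= 2^-1 by rewrite (le_trans _ h2)// normrM ler_piMr// clip_norm.
  by rewrite ler_norml => /andP[]; lra.
rewrite tilt_meanD eD eN in D2 *.
set A := tilt_exp t r in r0 D2 *; set B := tilt_exp t _ in r1 *.
have Dn0 : 1 + h * m + A != 0 by rewrite gt_eqF//; lra.
(* All zeroth and first order terms cancel exactly. Each of the three terms left in the numerator is
   at most [2 h^2], and the denominator is at least 1/2: this is the origin of 12. *)
have -> : (m + h * (v + m ^+ 2) + B) / (1 + h * m + A) - m - v * h =
  (B - m * A - h * v * (h * m + A)) / (1 + h * m + A) by field.
rewrite normrM normfV [`|1 + _ + _|]ger0_norm; last by lra.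
rewrite ler_pdivrMr; last by lra.
have h20 := sqr_ge0 h.
have mA : `|m * A| <= 2 * h ^+ 2.
  by rewrite normrM -[leRHS]mul1r ler_pM// ler_norml m0.
have hvh : `|h * v * (h * m + A)| <= 2 * h ^+ 2.
  have -> : h * v * (h * m + A) = h ^+ 2 * (v * m) + v * (h * A) by ring.
  rewrite (le_trans (ler_normD _ _))// (_ : 2 * h ^+ 2 = h ^+ 2 + h ^+ 2); last by ring.
  rewrite lerD//.
    rewrite normrM (ger0_norm h20) ler_piMr// normrM -[leRHS]mul1r ler_pM//.
      by rewrite ger0_norm.
    by rewrite ler_norml m0.
  have vle : `|v| <= 1 by rewrite ger0_norm.
  have hA : `|h * A| <= h ^+ 2.
    rewrite normrM (_ : h ^+ 2 = 2^-1 * (2 * h ^+ 2)); last by field.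
    exact: ler_pM.
  by rewrite normrM -[leRHS]mul1r; apply: ler_pM.
have : `|B - m * A - h * v * (h * m + A)| <= 6 * h ^+ 2.
  rewrite (le_trans (ler_normB _ _))// (_ : 6 * h ^+ 2 = 4 * h ^+ 2 + 2 * h ^+ 2); last by ring.
  rewrite lerD// (le_trans (ler_normB _ _))// (_ : 4 * h ^+ 2 = 2 * h ^+ 2 + 2 * h ^+ 2); last by ring.
  by rewrite lerD.
move=> /le_trans; apply.
rewrite (_ : 12 * h ^+ 2 * _ = 6 * h ^+ 2 * (2 * (1 + h * m + A))); last by ring.
by rewrite ler_peMr ?(mulr_ge0 _ h20)//; lra. 
Qed.

Lemma tilt_mean_lipschitz t h : `|tilt_mean (t + h) - tilt_mean t| <= `|h|.
Proof.
apply: (@lipschitz_of_taylor _ tilt_mean tilt_var 12) => //.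
- exact: tilt_var01.
- exact: tilt_mean_taylor.
Qed.

End Tilt.

(** * Operator norms *)

Section Norms.
Context {R : realType}.

Lemma cauchy_schwarz_sum (I : finType) (a b : I -> R) :
  (\sum_i a i * b i) ^+ 2 <= (\sum_i a i ^+ 2) * (\sum_i b i ^+ 2).
Proof.
have : 0 <= \sum_i \sum_j (a i * b j - a j * b i) ^+ 2.
  by apply: sumr_ge0 => i _; apply: sumr_ge0 => j _; exact: sqr_ge0.
suff -> : \sum_i \sum_j (a i * b j - a j * b i) ^+ 2 =
    2 * ((\sum_i a i ^+ 2) * (\sum_i b i ^+ 2) - (\sum_i a i * b i) ^+ 2).
  by rewrite pmulr_rge0// subr_ge0.
have e i : \sum_j (a i * b j - a j * b i) ^+ 2 =
    a i ^+ 2 * (\sum_j b j ^+ 2) + b i ^+ 2 * (\sum_j a j ^+ 2)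
    - 2 * (a i * b i) * (\sum_j a j * b j).
  rewrite !mulr_sumr -big_split -sumrB; apply: eq_bigr => j _ /=; ring.
under eq_bigr do rewrite e.
by rewrite sumrB big_split /= -!mulr_suml -mulr_sumr; ring.
Qed.

Variable p : nat.
Implicit Types (x u v : 'cV[R]_p) (A : 'M[R]_p).

Lemma norm4X4 x : norm4 x ^+ 4 = \sum_i x i 0 ^+ 4.
Proof.
have e : \sum_i `|x i 0| ^+ 4 = \sum_i x i 0 ^+ 4.
  apply: eq_bigr => i _; rewrite -normrX ger0_norm//.
  by rewrite (exprM _ 2 2) sqr_ge0.
rewrite /norm4 -powR_mulrn ?powR_ge0// -powRrM mulVf// powRr1 ?e//.
by apply: sumr_ge0 => i _; rewrite (exprM _ 2 2) sqr_ge0.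
Qed.

Lemma norm4_ge0 x : 0 <= norm4 x.
Proof. exact: powR_ge0. Qed.

Lemma norm4_le x c : 0 <= c -> (norm4 x <= c) = (\sum_i x i 0 ^+ 4 <= c ^+ 4).
Proof. by move=> c0; rewrite -norm4X4 ler_pXn2r ?nnegrE// norm4_ge0. Qed.

(** Without boundedness the supremum in [opnorm4] would be a default value and would carry no
    information about [A]. *)
Lemma opnorm4_has_ubound A :
  has_ubound [set norm4 (A *m x) | x in [set x | norm4 x <= 1]].
Proof.
pose K := \sum_i \sum_j `|A i j|.
have K0 : 0 <= K by apply: sumr_ge0 => i _; apply: sumr_ge0 => j _.
exists ((\sum_(i < p) K ^+ 4) `^ (4%:R^-1)) => _ [x /= x1 <-].
apply: ge0_ler_powR; rewrite ?invr_ge0 ?nnegrE//; do ?by apply: sumr_ge0 => *; exact: exprn_ge0.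
have xi i : `|x i 0| <= 1.
  rewrite -(@ler_pXn2r _ 4) ?nnegrE// expr1n -normrX ger0_norm; last first.
    by rewrite (exprM _ 2 2) sqr_ge0.
  move: x1; rewrite norm4_le// expr1n; apply: le_trans.
  rewrite (bigD1 i)//= lerDl sumr_ge0// => j _.
  by rewrite (exprM _ 2 2) sqr_ge0.
apply: ler_sum => i _; rewrite lerXn2r ?nnegrE// mxE.
rewrite (le_trans (ler_norm_sum _ _ _))//.
rewrite (@le_trans _ _ (\sum_j `|A i j|))//.
  by apply: ler_sum => j _; rewrite normrM ler_piMr.
by rewrite /K [leRHS](bigD1 i)//= lerDl sumr_ge0// => k _; exact: sumr_ge0.
Qed.

(** Homogeneity carries the bound from the unit ball to every vector; fourth powers replace the
    norms to avoid roots. *)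
Lemma opnorm4_sum_le A rho x : opnorm4 A <= rho ->
  \sum_i (A *m x) i 0 ^+ 4 <= rho ^+ 4 * \sum_i x i 0 ^+ 4.
Proof.
move=> Arho.
have ball y : norm4 y <= 1 -> norm4 (A *m y) <= rho.
  move=> y1; apply: le_trans Arho; apply: ub_le_sup; first exact: opnorm4_has_ubound.
  by exists y.
have rho0 : 0 <= rho.
  apply: le_trans (ball 0 _); first exact: norm4_ge0.
  by rewrite norm4_le// big1 ?expr1n// => i _; rewrite mxE expr0n.
have S4Z (c : R) (y : 'cV[R]_p) :
    \sum_i (c *: y) i 0 ^+ 4 = c ^+ 4 * \sum_i y i 0 ^+ 4.
  by rewrite mulr_sumr; apply: eq_bigr => i _; rewrite mxE exprMn.
set N := norm4 x.
have N4 : N ^+ 4 = \sum_i x i 0 ^+ 4 by exact: norm4X4.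
have [N0|N0] := eqVneq N 0.
  have x0 : x = 0.
    apply/matrixP => i j; rewrite ord1 mxE.
    have /eqP := N4; rewrite N0 expr0n /= eq_sym psumr_eq0; last first.
      by move=> k _; rewrite (exprM _ 2 2) sqr_ge0.
    by move=> /allP /(_ i); rewrite mem_index_enum expf_eq0 /= => /(_ isT) /eqP.
  by rewrite x0 mulmx0 !big1 ?mulr0// => i _; rewrite mxE expr0n.
have y1 : norm4 (N^-1 *: x) <= 1.
  by rewrite norm4_le// S4Z -N4 -exprMn mulVf.
have := ball _ y1; rewrite norm4_le// -scalemxAr S4Z -N4.
by rewrite exprVn mulrC ler_pdivrMr// exprn_gt0// lt0r N0 norm4_ge0.
Qed.

Lemma dotv_sym A u v : A^T = A -> dotv (A *m u) v = dotv u (A *m v).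
Proof.
have dE (s w : 'cV[R]_p) : dotv s w = (s^T *m w) 0 0.
  by rewrite mxE; apply: eq_bigr => i _; rewrite mxE.
by move=> AT; rewrite !dE trmx_mul AT mulmxA.
Qed.

Lemma dotv_cs u v : dotv u v ^+ 2 <= dotv u u * dotv v v.
Proof.
exact: le_trans (cauchy_schwarz_sum _ _) _.
Qed.

Lemma dotv_ge0 u : 0 <= dotv u u.
Proof. by apply: sumr_ge0 => i _; rewrite -expr2 sqr_ge0. Qed.

(* For symmetric A the sequence |A^k x| is log-convex, so |A x| / |x| is at
   most the exponential growth rate of |A^k x|, and that rate does not depend on
   the norm in which it is measured. *)
Lemma opnorm4_symmetric_l2 A rho x : A^T = A -> 0 < rho -> opnorm4 A <= rho ->
  dotv (A *m x) (A *m x) <= rho ^+ 2 * dotv x x.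
Proof.
move=> AT rho0 Arho.
pose it k := iter k (mulmx A) x.
pose a k := dotv (it k) (it k).
have itD k l : it (k + l)%N = iter k (mulmx A) (it l) by rewrite /it iterD.
have dit k u v : dotv (iter k (mulmx A) u) v = dotv u (iter k (mulmx A) v).
  elim: k u v => [//|k IH] u v.
  by rewrite iterS dotv_sym// IH -iterSr.
have logcvx k : a k ^+ 2 <= a 0%N * a (k + k)%N.
  by rewrite {1}/a {1}/it dit -itD; exact: dotv_cs.
(* A division-free form of [(a 1 / a 0)^(2^k) <= a (2^k) / a 0]. Along powers of two, Cauchy-Schwarz
   in the doubling form [logcvx] is all that the induction uses. *)
have power k : a 1%N ^+ (2 ^ k) * a 0%N <= a 0%N ^+ (2 ^ k) * a (2 ^ k)%N.
  elim: k => [|k IH]; first by rewrite expn0 !expr1 mulrC.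
  have [a00|a00] := eqVneq (a 0%N) 0.
    by rewrite a00 mulr0 mulr_ge0 ?exprn_ge0// dotv_ge0.
  have a0p : 0 < a 0%N by rewrite lt0r a00 dotv_ge0.
  have e2 (t : R) : t ^+ (2 ^ k.+1) = (t ^+ (2 ^ k)) ^+ 2 by rewrite expnSr exprM.
  rewrite -(ler_pM2r a0p) !e2.
  have H : (a 1%N ^+ (2 ^ k) * a 0%N) ^+ 2 <= (a 0%N ^+ (2 ^ k) * a (2 ^ k)%N) ^+ 2.
    by rewrite lerXn2r// ?nnegrE ?mulr_ge0 ?exprn_ge0 ?dotv_ge0.
  rewrite !(exprMn 2) in H.
  rewrite -mulrA -expr2 (le_trans H)// -[leRHS]mulrA.
  rewrite ler_wpM2l ?exprn_ge0 ?dotv_ge0// mulrC.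
  by rewrite expnS mul2n -addnn logcvx.
(* The factor [p] is the price of comparing l2 with l4. The summand 1 ensures [K <= K^2], so that
   [growth] can be checked after squaring. *)
pose K := p%:R * (\sum_i x i 0 ^+ 4) + 1.
have x40 : 0 <= \sum_i x i 0 ^+ 4.
  by apply: sumr_ge0 => i _; rewrite (exprM _ 2 2) sqr_ge0.
have K1 : 1 <= K by rewrite lerDr mulr_ge0.
have growth n : a n <= K * (rho ^+ 2) ^+ n.
  have S4n : \sum_i (it n) i 0 ^+ 4 <= (rho ^+ 4) ^+ n * \sum_i x i 0 ^+ 4.
    elim: n => [|n IH]; first by rewrite expr0 mul1r.
    rewrite /it iterS (le_trans (opnorm4_sum_le _ Arho))//.
    by rewrite [(rho ^+ 4) ^+ n.+1]exprS -mulrA ler_pM2l// exprn_gt0.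
  rewrite -(@ler_pXn2r _ 2)// ?nnegrE ?dotv_ge0//; last first.
    by rewrite mulr_ge0 ?exprn_ge0// ?(ltW rho0)// (le_trans ler01).
  have := cauchy_schwarz_sum (fun=> 1) (fun i => (it n) i 0 ^+ 2).
  rewrite (_ : \sum_i 1 * _ = a n); last first.
    by apply: eq_bigr => i _; rewrite mul1r expr2.
  under eq_bigr do rewrite expr1n.
  rewrite sumr_const card_ord => /le_trans; apply.
  have -> : \sum_i ((it n) i 0 ^+ 2) ^+ 2 = \sum_i (it n) i 0 ^+ 4.
    by apply: eq_bigr => i _; rewrite -exprM.
  have -> : (K * (rho ^+ 2) ^+ n) ^+ 2 = (rho ^+ 4) ^+ n * K ^+ 2.
    by rewrite (exprMn 2) -!exprM mulrC mulnAC.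
  rewrite (le_trans (ler_wpM2l _ S4n))// mulrCA ler_wpM2l//.
    by rewrite !exprn_ge0// ltW.
  rewrite (@le_trans _ _ K)// ?lerDl//.
  by rewrite expr2 ler_peMr// (le_trans ler01).
rewrite leNgt; apply/negP => lt1; have {}lt1 : rho ^+ 2 * a 0%N < a 1%N by [].
have [a00|a00] := eqVneq (a 0%N) 0.
  have := growth 1%N; have x0 : x = 0.
    apply/matrixP => i j; rewrite ord1 mxE.
    move/eqP: a00; rewrite psumr_eq0; last by move=> k _; rewrite -expr2 sqr_ge0.
    by move=> /allP /(_ i); rewrite mem_index_enum -expr2 expf_eq0 => /(_ isT) /eqP.
  have z : dotv (0 : 'cV[R]_p) 0 = 0.
    by rewrite /dotv big1// => i _; rewrite mxE mul0r.
  by move: lt1; rewrite /a /it /= x0 mulmx0 z mulr0 ltxx.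
have a0p : 0 < a 0%N by rewrite lt0r a00 dotv_ge0.
have rho2 : 0 < rho ^+ 2 by exact: exprn_gt0.
(* If the claim fails then [r > 1], although [power] and [growth] bound every [r^(2^k)] by the fixed
   number [K / a 0]. Bernoulli's inequality makes these powers unbounded. *)
pose r := a 1%N / (rho ^+ 2 * a 0%N).
have r1 : 1 < r by rewrite ltr_pdivlMr ?mul1r ?mulr_gt0.
have rk k : r ^+ (2 ^ k) <= K / a 0%N.
  rewrite expr_div_n ler_pdivrMr ?exprn_gt0 ?mulr_gt0//.
  rewrite -(ler_pM2r a0p) (le_trans (power k))// exprMn.
  rewrite (_ : K / a 0%N * _ * _ = a 0%N ^+ (2 ^ k) * (K * (rho ^+ 2) ^+ (2 ^ k))); last first.
    by field.
  by rewrite ler_pM2l ?exprn_gt0.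
have bern k : 1 + k%:R * (r - 1) <= r ^+ (2 ^ k).
  rewrite (@le_trans _ _ (1 + (2 ^ k)%:R * (r - 1)))//.
    rewrite lerD2l ler_pM2r ?subr_gt0// ler_nat ltnW// ltn_expl//.
  elim: (2 ^ k)%N => [|m IH]; first by rewrite mul0r addr0.
  rewrite exprS -natr1; have m0 : 0 <= m%:R :> R by [].
  apply: le_trans (_ : r * (1 + m%:R * (r - 1)) <= _); last by rewrite ler_pM2l//; lra.
  rewrite -subr_ge0 (_ : _ - _ = m%:R * (r - 1) ^+ 2); last by ring.
  by rewrite mulr_ge0// sqr_ge0.
pose k := (Num.truncn (K / a 0%N / (r - 1))).+1.
have : K / a 0%N / (r - 1) < k%:R by apply: truncnS_gt.
rewrite ltr_pdivrMr ?subr_gt0//.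
have := le_trans (bern k) (rk k); rewrite leNgt => /negP h h'; apply: h.
by rewrite (lt_le_trans h')// lerDr.
Qed.

End Norms.

(** * Deterministic bounds for the effect of freezing one coordinate *)

Section Increments.
Context {R : realType} (p : nat).
Implicit Types (a D x v dl e : 'I_p -> R) (A : 'I_p -> 'I_p -> R).

(* 438 = 3 (1 + 1 + 12^2), where 12 is the constant of [tilt_mean_taylor]. *)
Lemma sum_sqr_increments A a D x (r : 'I_p -> 'I_p -> R) dl :
  (forall v, \sum_i (\sum_j A i j * v j) ^+ 2 <= \sum_i v i ^+ 2) ->
  (forall i j, A i j = A j i) ->
  (forall i, \sum_j A i j ^+ 2 <= 1) ->
  (forall k, 0 <= D k <= 1) -> (forall k, `|x k| <= 1) ->
  (forall k j, `|r k j| <= 12 * A k j ^+ 2) ->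
  (forall j, dl j = a j * x j - x j * (\sum_k A j k * (D k * a k)) +
     \sum_k a k * r k j) ->
  \sum_j dl j ^+ 2 <= 438 * \sum_k a k ^+ 2.
Proof.
move=> l2 Asym row D01 x1 r12 dlE.
pose w j := \sum_k A j k * (D k * a k).
pose s j := \sum_k a k * r k j.
have x2 k : x k ^+ 2 <= 1.
  by rewrite -real_normK ?num_real// exprn_ile1.
have pt j : dl j ^+ 2 <= 3 * a j ^+ 2 + 3 * w j ^+ 2 + 3 * s j ^+ 2.
  rewrite dlE -/(w j) -/(s j).
  have h1 : (a j * x j) ^+ 2 <= a j ^+ 2 by rewrite exprMn ler_piMr ?sqr_ge0.
  have h2 : (x j * w j) ^+ 2 <= w j ^+ 2 by rewrite exprMn ler_piMl ?sqr_ge0.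
  set P := a j * x j in h1 *; set Q := x j * w j in h2 *.
  have := sqr_ge0 (P + Q); have := sqr_ge0 (P - s j); have := sqr_ge0 (Q + s j).
  by lra.
have hw : \sum_j w j ^+ 2 <= \sum_k a k ^+ 2.
  rewrite (le_trans (l2 (fun k => D k * a k)))//; apply: ler_sum => k _.
  have /andP[d0 d1] := D01 k.
  by rewrite exprMn ler_piMl ?sqr_ge0// expr2 mulr_ile1.
(* Cauchy-Schwarz with [A k j ^+ 2] split as [|A k j| |A k j|]: one factor is absorbed by the [j]-th
   column sum, a row sum by symmetry; the other is absorbed by the [k]-th row sum after summing over
   [j]. *)
have hs : \sum_j s j ^+ 2 <= 144 * \sum_k a k ^+ 2.
  have st j : s j ^+ 2 <= 144 * \sum_k a k ^+ 2 * A k j ^+ 2.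
    have sb : `|s j| <= 12 * \sum_k (`|a k| * `|A k j|) * `|A k j|.
      rewrite (le_trans (ler_norm_sum _ _ _))// mulr_sumr; apply: ler_sum => k _.
      rewrite normrM (_ : 12 * _ = `|a k| * (12 * (`|A k j| * `|A k j|))); last by ring.
      by rewrite ler_wpM2l// -expr2 real_normK ?num_real.
    rewrite -real_normK ?num_real//.
    rewrite (@le_trans _ _ ((12 * \sum_k (`|a k| * `|A k j|) * `|A k j|) ^+ 2))//.
      by rewrite lerXn2r// nnegrE (le_trans _ sb).
    rewrite exprMn (_ : 12 ^+ 2 = 144 :> R); last by ring.
    rewrite ler_pM2l//.
    have cs := cauchy_schwarz_sum (fun k => `|a k| * `|A k j|) (fun k => `|A k j|).
    rewrite (le_trans cs)//.
    have -> : \sum_k (`|a k| * `|A k j|) ^+ 2 = \sum_k a k ^+ 2 * A k j ^+ 2.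
      by apply: eq_bigr => k _; rewrite exprMn !real_normK ?num_real.
    rewrite ler_piMr//; first by apply: sumr_ge0 => k _; rewrite mulr_ge0 ?sqr_ge0.
    apply: le_trans (row j); apply: ler_sum => k _.
    by rewrite real_normK ?num_real// Asym.
  rewrite (le_trans (ler_sum _ (fun j _ => st j)))// -mulr_sumr ler_pM2l//.
  rewrite exchange_big /=; apply: ler_sum => k _.
  by rewrite -mulr_sumr ler_piMr// sqr_ge0.
rewrite (le_trans (ler_sum _ (fun j _ => pt j)))// !big_split /= -!mulr_sumr.
by lra.
Qed.

(** Factoring [dl j] out of the difference of cubes bounds the sum by [W (9 f^2 + 5 W)] with
    [W = K |a|^2]. Young's inequality gives [9 f^2 W <= f^4 / 2 + 81 W^2 / 2], and 40.5 + 5 is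
    rounded up to 46. The coefficient 1/2 of [f^4] leaves room to absorb the fourth moment. *)
Lemma cubic_increments a e dl (f K : R) : 1 <= K -> (forall j, `|e j| <= 2) ->
  \sum_j dl j ^+ 2 <= K * \sum_j a j ^+ 2 ->
  \sum_j a j * (e j * (f ^+ 3 - (f - dl j) ^+ 3)) <=
  2^-1 * f ^+ 4 + 46 * (K * \sum_j a j ^+ 2) ^+ 2.
Proof.
move=> K1 e2; set S := \sum_j a j ^+ 2 => dlK.
have S0 : 0 <= S by apply: sumr_ge0 => j _; exact: sqr_ge0.
have SKS : S <= K * S by rewrite ler_peMl.
have dlj j : dl j ^+ 2 <= K * S.
  apply: le_trans dlK; rewrite (bigD1 j)//= lerDl sumr_ge0// => i _.
  exact: sqr_ge0.
have term j : a j * (e j * (f ^+ 3 - (f - dl j) ^+ 3)) <=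
    `|a j| * `|dl j| * (9 * f ^+ 2 + 5 * (K * S)).
  rewrite (le_trans (ler_norm _))// normrM -mulrA ler_wpM2l// normrM.
  have -> : f ^+ 3 - (f - dl j) ^+ 3 = dl j * (3 * f ^+ 2 - 3 * f * dl j + dl j ^+ 2).
    by ring.
  rewrite normrM mulrCA ler_wpM2l//.
  set E := 3 * f ^+ 2 - _ + _.
  have E0 : 0 <= E by have := sqr_ge0 (3 * f - 2 * dl j); have := sqr_ge0 f;
     have := sqr_ge0 (f - dl j); have := sqr_ge0 (dl j); rewrite /E; nra.
  rewrite (ger0_norm E0) (@le_trans _ _ (2 * E))// ?ler_wpM2r//.
  have := sqr_ge0 (f + dl j); have := dlj j; rewrite /E; lra.
rewrite (le_trans (ler_sum _ (fun j _ => term j)))// -mulr_suml.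
have ad : \sum_j `|a j| * `|dl j| <= K * S.
  rewrite (@le_trans _ _ (\sum_j 2^-1 * (a j ^+ 2 + dl j ^+ 2)))//.
    apply: ler_sum => j _.
    rewrite -(real_normK (num_real (a j))) -(real_normK (num_real (dl j))).
    have := sqr_ge0 (`|a j| - `|dl j|); lra.
  rewrite -mulr_sumr big_split /= -/S; lra.
rewrite (@le_trans _ _ (K * S * (9 * f ^+ 2 + 5 * (K * S))))//.
  rewrite ler_wpM2r// addr_ge0// mulr_ge0// ?sqr_ge0//.
  exact: le_trans S0 SKS.
set W := K * S; have := sqr_ge0 (f ^+ 2 - 9 * W); have := sqr_ge0 W.
have -> : f ^+ 4 = (f ^+ 2) ^+ 2 by rewrite -exprM.
lra.
Qed.

End Increments.

(** * Weighted convexity of squares and fourth powers *)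

Section Convexity.
Context {R : realType}.

Lemma sqrD_weighted (r x y : R) : 0 < r -> r < 1 ->
  (x + y) ^+ 2 <= x ^+ 2 / (1 - r) + y ^+ 2 / r.
Proof.
move=> r0 r1; have s0 : 0 < 1 - r by lra.
rewrite -subr_ge0.
have -> : x ^+ 2 / (1 - r) + y ^+ 2 / r - (x + y) ^+ 2 =
   (r * x - (1 - r) * y) ^+ 2 / (r * (1 - r)).
  by field; rewrite !gt_eqF.
by rewrite mulr_ge0 ?sqr_ge0// invr_ge0 mulr_ge0// ltW.
Qed.

(** Two applications of the quadratic case. With [r = rho], an l4 contraction of the second term
    turns [rho^4 / rho^3] into [rho < 1], which can be absorbed. *)
Lemma expr4D_weighted (r x y : R) : 0 < r -> r < 1 ->
  (x + y) ^+ 4 <= x ^+ 4 / (1 - r) ^+ 3 + y ^+ 4 / r ^+ 3.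
Proof.
move=> r0 r1; have s0 : 0 < 1 - r by lra.
have := sqrD_weighted x y r0 r1.
have := sqrD_weighted (x ^+ 2 / (1 - r)) (y ^+ 2 / r) r0 r1.
have e4 (t : R) : t ^+ 4 = (t ^+ 2) ^+ 2 by rewrite -exprM.
rewrite (e4 (x + y)) => h1 h2.
rewrite (@le_trans _ _ ((x ^+ 2 / (1 - r) + y ^+ 2 / r) ^+ 2))//.
  by rewrite lerXn2r// nnegrE ?sqr_ge0// (le_trans (sqr_ge0 _) h2).
apply: (le_trans h1); rewrite le_eqVlt; apply/orP; left; apply/eqP.
by field; rewrite !gt_eqF.
Qed.

End Convexity.

(** * Fourth moments under the posterior *)

Lemma measurable_tilt_mean (R : realType) (mu : probability (Rmeas R) R) d :
  measurable_fun setT (tilt_mean mu d).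
Proof.
apply: continuous_measurable_fun => t.
apply/cvgrPdist_lt => e e0; near=> s.
rewrite distrC (_ : s = t + (s - t)); last by rewrite addrC subrK.
rewrite (le_lt_trans (tilt_mean_lipschitz _ _ _ _))// distrC.
Unshelve. all: by end_near.
Qed.

Section Gibbs.
Context {R : realType} (p : nat).
Local Notation T := (p.-tuple (Rmeas R)).

Definition xc (i : 'I_p) (b : T) : R := clip (tnth b i).

Variables (mu : probability (Rmeas R) R) (A : 'I_p -> 'I_p -> R) (c d : 'I_p -> R).

Definition local_field (i : 'I_p) (b : T) : R := \sum_j A i j * xc j b.

Definition cond_mean (i : 'I_p) (t : R) : R := tilt_mean mu (d i) (c i + t).

Variables (V : T -> R) (nu : probability T R).

Hypothesis bV : bounded_measurable V.
Hypothesis nuV : density_of nu (prod_prob (fun=> mu)) (fun b => expR (V b)).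
Hypothesis Vupd : forall b i z, V (upd i b z) =
  V (upd i b 0) + ((c i + local_field i b) * clip z - d i / 2 * clip z ^+ 2).
Hypothesis A0 : forall i, A i i = 0.
Hypothesis Asym : forall i j, A i j = A j i.

Lemma bm_xc i : bounded_measurable (xc i).
Proof.
case: (@bm_clip R) => mc [M cM]; split; last by exists M => b; exact: cM.
exact: (measurableT_comp mc (measurable_tnth i)).
Qed.

Lemma xc_norm i b : `|xc i b| <= 1.
Proof. exact: clip_norm. Qed.

Lemma xc_upd i j b z : xc j (upd i b z) = if j == i then clip z else xc j b.
Proof. by rewrite /xc tnth_upd; case: eqP. Qed.

Lemma bm_local_field i : bounded_measurable (local_field i).
Proof. by apply: bm_sum => j; apply: bmM; [exact: bm_cst|exact: bm_xc]. Qed.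

Lemma bm_cond_mean i : bounded_measurable (fun b => cond_mean i (local_field i b)).
Proof.
split; last by exists 1 => b; exact: tilt_mean_norm.
apply: (measurableT_comp (measurable_tilt_mean mu (d i))).
apply: measurable_funD => //; exact: bm_measurable (bm_local_field i).
Qed.

Lemma local_field_upd i b z : local_field i (upd i b z) = local_field i b.
Proof.
apply: eq_bigr => j _; rewrite xc_upd; case: eqP => // ->.
by rewrite A0 !mul0r.
Qed.

Lemma local_field_upd0 k j b :
  local_field k (upd j b 0) = local_field k b - A k j * xc j b.
Proof.
have clip0 : clip (0 : R) = 0 by rewrite clip_id//; lra.
rewrite /local_field (bigD1 j)//= [in RHS](bigD1 j)//= xc_upd eqxx clip0 mulr0 add0r.
rewrite [RHS]addrC addKr; apply: eq_bigr => i /negbTE ij.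
by rewrite xc_upd ij.
Qed.

Definition resid i (b : T) : R := xc i b - cond_mean i (local_field i b).

Lemma bm_resid i : bounded_measurable (resid i).
Proof. by apply: bmB; [exact: bm_xc|exact: bm_cond_mean]. Qed.

Lemma resid_norm i b : `|resid i b| <= 2.
Proof.
rewrite (le_trans (ler_normB _ _))// (_ : 2 = 1 + 1)//.
by rewrite lerD ?xc_norm// tilt_mean_norm.
Qed.

(** By [Vupd] the conditional law of coordinate [j] given the others is the prior tilted at
    [c j + local_field j b], whose mean is what [resid] subtracts. The function [g] and the rest of
    the density are constant in that coordinate and factor out. *)
Lemma gibbs_resid j (g : T -> R) : bounded_measurable g ->
  (forall b z, g (upd j b z) = g b) -> \int[nu]_b (resid j b * g b) = 0.
Proof.
move=> bg gupd.
have bres : bounded_measurable (fun b => resid j b * g b).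
  by apply: bmM => //; exact: bm_resid.
rewrite (bm_density_integral nuV)//; last exact: bm_expR.
rewrite (@bm_int_resample _ _ (fun=> mu) (fun=> mu) j)//; last first.
  by apply: bmM => //; exact: bm_expR.
rewrite -[RHS](int_cst (@prod_prob R p (fun=> mu))); apply: eq_Rintegral => b _.
set t := c j + local_field j b.
have bw := bm_tilt_weight (d j) t.
have bc := @bm_clip R.
transitivity (\int[mu]_z ((g b * expR (V (upd j b 0))) *
  (clip z * tilt_weight (d j) t z - tilt_mean mu (d j) t * tilt_weight (d j) t z))).
  apply: eq_Rintegral => z _.
  rewrite gupd /resid local_field_upd xc_upd eqxx Vupd expRD -/t.
  by rewrite /cond_mean -/t /tilt_weight; ring.
have b1 : @bounded_measurable _ (Rmeas R) R (fun z => clip z * tilt_weight (d j) t z).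
  exact: bmM.
have b2 : @bounded_measurable _ (Rmeas R) R
    (fun z => tilt_mean mu (d j) t * tilt_weight (d j) t z).
  by apply: bmM => //; exact: bm_cst.
rewrite bm_intZ; last exact: bmB.
rewrite bm_intB// bm_intZ//.
rewrite {1}/tilt_mean {1}/tilt_exp -/(tilt_mass mu (d j) t) divfK ?subrr ?mulr0//.
by rewrite gt_eqF// tilt_mass_gt0.
Qed.

Lemma gibbs_mean i :
  \int[nu]_b xc i b = \int[nu]_b cond_mean i (local_field i b).
Proof.
have := @gibbs_resid i (fun=> 1) (@bm_cst _ _ _ _) (fun _ _ => erefl).
under eq_Rintegral do rewrite mulr1.
rewrite bm_intB; [|exact: bm_xc|exact: bm_cond_mean].
by move/eqP; rewrite subr_eq0 => /eqP.
Qed.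

Hypothesis l2 : forall v : 'I_p -> R,
  \sum_i (\sum_j A i j * v j) ^+ 2 <= \sum_i v i ^+ 2.
Hypothesis row : forall i, \sum_j A i j ^+ 2 <= 1.

Definition lin_resid (a : 'I_p -> R) (b : T) : R := \sum_k a k * resid k b.

Lemma bm_lin_resid a : bounded_measurable (lin_resid a).
Proof. by apply: bm_sum => k; apply: bmM; [exact: bm_cst|exact: bm_resid]. Qed.

(** Freezing coordinate [j] at 0 shifts the local field at [k] by [A k j * xc j b]. The linear
    response goes into the term with [D], and the Taylor remainder [r k j] is quadratic in
    [A k j]. *)
Lemma lin_resid_increments a b :
  \sum_j (lin_resid a b - lin_resid a (upd j b 0)) ^+ 2 <= 438 * \sum_k a k ^+ 2.
Proof.
have clip0 : clip (0 : R) = 0 by rewrite clip_id//; lra.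
pose D k := tilt_var mu (d k) (c k + local_field k b).
pose r k j := cond_mean k (local_field k b - A k j * xc j b)
  - cond_mean k (local_field k b) + D k * (A k j * xc j b).
apply: (@sum_sqr_increments _ _ A a D (fun k => xc k b) r) => //.
- by move=> k; exact: tilt_var01.
- by move=> k; exact: xc_norm.
- move=> k j; have := tilt_mean_taylor mu (d k) (c k + local_field k b) (- (A k j * xc j b)).
  rewrite mulrN opprK -[c k + _ + _]addrA => /le_trans; apply.
  rewrite ler_pM2l// sqrrN exprMn ler_piMr ?sqr_ge0//.
  by rewrite -real_normK ?num_real// exprn_ile1 ?xc_norm.
- move=> j; rewrite /lin_resid -sumrB mulr_sumr.
  rewrite (_ : a j * xc j b = \sum_k (if k == j then a k * xc k b else 0)); last first.
    by rewrite -big_mkcond /= big_pred1_eq.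
  rewrite -sumrB -big_split /=; apply: eq_bigr => k _.
  rewrite /resid xc_upd clip0 local_field_upd0 /r (Asym j k).
  have same (m m' Dk x Ak ak : R) : ak * (x - m) - ak * (0 - m') =
    ak * x - x * (Ak * (Dk * ak)) + ak * (m' - m + Dk * (Ak * x)) by ring.
  have diff (m m' Dk x xk Ak ak : R) : ak * (xk - m) - ak * (xk - m') =
    0 - x * (Ak * (Dk * ak)) + ak * (m' - m + Dk * (Ak * x)) by ring.
  by case: eqP => [->|_]; [exact: same|exact: diff].
Qed.

(** The estimate is self-bounding: half of the fourth moment reappears on the right, and moving it
    to the left doubles 46 into 92. *)
Lemma lin_resid_moment4 a :
  \int[nu]_b (lin_resid a b ^+ 4) <= 92 * (438 * \sum_k a k ^+ 2) ^+ 2.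
Proof.
have bl := bm_lin_resid a.
have incr := lin_resid_increments a.
have fE b : lin_resid a b = \sum_k a k * resid k b by [].
move: (lin_resid a) bl incr fE => f bl incr fE.
set S := \sum_k a k ^+ 2.
have bupd j : bounded_measurable (fun b => f (upd j b 0)).
  case: bl => mf [M fM]; split; last by exists M => b; exact: (fM (upd j b 0)).
  exact: (measurableT_comp mf (measurable_updl j 0)).
have bterm j : bounded_measurable (fun b => a j * (resid j b *
    (f b ^+ 3 - f (upd j b 0) ^+ 3))).
  apply: bmM; first exact: bm_cst.
  apply: bmM; first exact: bm_resid.
  by apply: bmB; exact: bmX.
have e : \int[nu]_b (f b ^+ 4) =
    \int[nu]_b (\sum_j a j * (resid j b *
      (f b ^+ 3 - f (upd j b 0) ^+ 3))).
  rewrite bm_int_sum//.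
  transitivity (\int[nu]_b (\sum_j a j * (resid j b * f b ^+ 3))).
    apply: eq_Rintegral => b _; rewrite exprS {1}fE mulr_suml.
    by apply: eq_bigr => j _; rewrite mulrA.
  rewrite bm_int_sum; last first.
    by move=> j; apply: bmM; [exact: bm_cst|apply: bmM; [exact: bm_resid|exact: bmX]].
  apply: eq_bigr => j _.
  rewrite !bm_intZ; last 2 first.
  - by apply: bmM; [exact: bm_resid|apply: bmB; exact: bmX].
  - by apply: bmM; [exact: bm_resid|exact: bmX].
  congr (_ * _); rewrite -[LHS]subr0.
  rewrite -[X in _ - X = _](@gibbs_resid j (fun b => f (upd j b 0) ^+ 3)); last 2 first.
  - exact: bmX.
  - by move=> b z; rewrite upd_upd.
  rewrite -bm_intB; last 2 first.
  - by apply: bmM; [exact: bm_resid|exact: bmX].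
  - by apply: bmM; [exact: bm_resid|exact: bmX].
  by apply: eq_Rintegral => b _; rewrite mulrBr.
have : \int[nu]_b (f b ^+ 4) <=
    \int[nu]_b (2^-1 * f b ^+ 4 + 46 * (438 * S) ^+ 2).
  rewrite {1}e; apply: bm_int_le.
  - exact: bm_sum.
  - by apply: bmD; [apply: bmM; [exact: bm_cst|exact: bmX]|exact: bm_cst].
  - move=> b.
    rewrite (_ : \sum_j _ = \sum_j a j * (resid j b *
      (f b ^+ 3 - (f b - (f b - f (upd j b 0))) ^+ 3))); last first.
      by apply: eq_bigr => j _; rewrite subKr.
    apply: (@cubic_increments _ _ a (fun j => resid j b)) => //; first by lra.
    by move=> j; exact: resid_norm.
rewrite bm_intD; [|by apply: bmM; [exact: bm_cst|exact: bmX]|exact: bm_cst].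
rewrite int_cst bm_intZ; last exact: bmX.
lra.
Qed.

Variables (rho al : R) (u : 'I_p -> R).
Hypotheses (rho0 : 0 < rho) (rho1 : rho < 1).
Hypothesis l2rho : forall v : 'I_p -> R,
  \sum_i (\sum_j A i j * v j) ^+ 2 <= rho ^+ 2 * \sum_i v i ^+ 2.
Hypothesis l4rho : forall v : 'I_p -> R,
  \sum_i (\sum_j A i j * v j) ^+ 4 <= rho ^+ 4 * \sum_i v i ^+ 4.
Hypothesis row_al : forall i, \sum_j A i j ^+ 2 <= al.
Hypothesis u_fixpoint : forall i, u i = cond_mean i (\sum_j A i j * u j).

Let s i := \sum_j A i j * u j.
Let dev i b := local_field i b - s i.

Let bm_dev i : bounded_measurable (dev i).
Proof. by apply: bmB; [exact: bm_local_field|exact: bm_cst]. Qed.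

Let expr4_ge0 (t : R) : 0 <= t ^+ 4.
Proof. by rewrite (exprM _ 2 2) sqr_ge0. Qed.

Let dev_lipschitz j b : (cond_mean j (local_field j b) - u j) ^+ 4 <= dev j b ^+ 4.
Proof.
have e4 (t : R) : t ^+ 4 = `|t| ^+ 4.
  by rewrite -normrX ger0_norm.
rewrite e4 [leRHS]e4 lerXn2r ?nnegrE//.
have := tilt_mean_lipschitz mu (d j) (c j + s j) (dev j b).
rewrite u_fixpoint -/(s j) /cond_mean.
by rewrite (_ : c j + s j + dev j b = c j + local_field j b)// /dev -addrA (addrC (s _)) subrK.
Qed.

(** This holds for every [b], not only on average. With weights [1 - rho] and [rho], the l4 bound
    and the Lipschitz bound return at most [rho] times the left side; absorbing it costs one more
    factor [1 - rho]. *)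
Let dev_contraction b :
  \sum_i dev i b ^+ 4 <= (\sum_i lin_resid (A i) b ^+ 4) / (1 - rho) ^+ 4.
Proof.
have s0 : 0 < 1 - rho by rewrite subr_gt0.
have split i : dev i b = lin_resid (A i) b +
    \sum_j A i j * (cond_mean j (local_field j b) - u j).
  rewrite /dev /s /local_field /lin_resid -sumrB -big_split /=.
  by apply: eq_bigr => j _; rewrite /resid /local_field -mulrBr -mulrDr addrA subrK.
have pt i : dev i b ^+ 4 <= (1 - rho) ^- 3 * lin_resid (A i) b ^+ 4 +
    rho ^- 3 * (\sum_j A i j * (cond_mean j (local_field j b) - u j)) ^+ 4.
  by rewrite split mulrC [_ ^- 3 * _]mulrC; exact: expr4D_weighted.
have := ler_sum (index_enum 'I_p) (fun i (_ : true) => pt i).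
rewrite big_split /= -!mulr_sumr.
set S := \sum_i dev i b ^+ 4; set W := \sum_i lin_resid _ _ ^+ 4.
set Y := \sum_i (\sum_j _) ^+ 4 => h.
have hY : rho ^- 3 * Y <= rho * S.
  rewrite ler_pdivrMl ?exprn_gt0// mulrA -exprSr.
  rewrite (le_trans (l4rho _))// ler_wpM2l//.
  by apply: ler_sum => j _; exact: dev_lipschitz.
rewrite ler_pdivlMr ?exprn_gt0//.
rewrite exprSr mulrA mulrAC -ler_pdivlMr ?exprn_gt0// [leRHS]mulrC.
lra.
Qed.

Let dev_moment4 : \sum_i \int[nu]_b (dev i b ^+ 4) <=
  p%:R * (92 * (438 * al) ^+ 2) / (1 - rho) ^+ 4.
Proof.
have s0 : 0 < 1 - rho by rewrite subr_gt0.
have b4 i : bounded_measurable (fun b => lin_resid (A i) b ^+ 4).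
  by apply: bmX; exact: bm_lin_resid.
rewrite -bm_int_sum; last by move=> i; apply: bmX; exact: bm_dev.
apply: (@le_trans _ _ (\int[nu]_b ((1 - rho) ^- 4 * \sum_i lin_resid (A i) b ^+ 4))).
  apply: bm_int_le.
  - by apply: bm_sum => i; apply: bmX; exact: bm_dev.
  - by apply: bmM; [exact: bm_cst|exact: bm_sum].
  - by move=> b; rewrite mulrC; exact: dev_contraction.
rewrite bm_intZ; last exact: bm_sum.
rewrite mulrC ler_pM2r ?invr_gt0 ?exprn_gt0// bm_int_sum//.
apply: (@le_trans _ _ (\sum_(i < p) 92 * (438 * al) ^+ 2)); last first.
  by rewrite sumr_const card_ord -[leLHS]mulr_natl.
apply: ler_sum => i _; rewrite (le_trans (lin_resid_moment4 _))// ler_pM2l//.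
have r0 : 0 <= \sum_j A i j ^+ 2 by apply: sumr_ge0 => j _; exact: sqr_ge0.
have r1 := row_al i.
have mono (k x z : R) : 0 <= k -> 0 <= x -> x <= z -> (k * x) ^+ 2 <= (k * z) ^+ 2.
  move=> k0 x0 xz; have z0 := le_trans x0 xz.
  by apply: lerXn2r; rewrite ?nnegrE; [exact: mulr_ge0|exact: mulr_ge0|exact: ler_wpM2l].
exact: mono _ _ _ (ler0n _ _) r0 r1.
Qed.

(** In the constant, 144 is the square of the Taylor constant 12, and [92 * 438 ^+ 2] comes from the
    fourth moment of [lin_resid]. The power 6 is 4 from the l4 contraction plus 2 from the l2
    absorption of [A w]. *)
Lemma gibbs_mean_fixpoint_error : \sum_i (\int[nu]_b xc i b - u i) ^+ 2 <=
  144 * (92 * 438 ^+ 2) / (1 - rho) ^+ 6 * (p%:R * al ^+ 2).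
Proof.
have s0 : 0 < 1 - rho by rewrite subr_gt0.
pose w i := \int[nu]_b xc i b - u i.
pose D i := tilt_var mu (d i) (c i + s i).
pose rem i b := cond_mean i (local_field i b) - u i - D i * dev i b.
pose r i := \int[nu]_b rem i b.
have brem i : bounded_measurable (rem i).
  apply: bmB; first by apply: bmB; [exact: bm_cond_mean|exact: bm_cst].
  by apply: bmM; [exact: bm_cst|exact: bm_dev].
have rem_le i b : rem i b ^+ 2 <= 144 * dev i b ^+ 4.
  have := tilt_mean_taylor mu (d i) (c i + s i) (dev i b).
  rewrite (_ : c i + s i + dev i b = c i + local_field i b); last first.
    by rewrite /dev -addrA (addrC (s _)) subrK.
  rewrite -[tilt_mean _ _ (c i + s i)]/(cond_mean i (s i)) -u_fixpoint.
  rewrite -/(D i) -/(cond_mean i (local_field i b)) -/(rem i b) => h.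
  rewrite -(real_normK (num_real (rem i b))).
  rewrite (_ : 144 * _ = (12 * dev i b ^+ 2) ^+ 2); last by ring.
  by rewrite lerXn2r// nnegrE (le_trans _ h).
have r2 i : r i ^+ 2 <= 144 * \int[nu]_b (dev i b ^+ 4).
  rewrite (le_trans (bm_int_sqr _ (brem i)))// -bm_intZ; last by apply: bmX; exact: bm_dev.
  apply: bm_int_le; first exact: bmX.
    by apply: bmM; [exact: bm_cst|apply: bmX; exact: bm_dev].
  exact: rem_le.
have devE i : \int[nu]_b dev i b = \sum_j A i j * w j.
  transitivity (\int[nu]_b (\sum_j A i j * (xc j b - u j))).
    apply: eq_Rintegral => b _; rewrite /dev /s /local_field -sumrB.
    by apply: eq_bigr => j _; rewrite mulrBr.
  have bx j : bounded_measurable (fun b => xc j b - u j).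
    by apply: bmB; [exact: bm_xc|exact: bm_cst].
  rewrite bm_int_sum; last by move=> j; apply: bmM; [exact: bm_cst|].
  apply: eq_bigr => j _; rewrite bm_intZ// bm_intB ?int_cst//; first exact: bm_xc.
  exact: bm_cst.
have wE i : w i = r i + D i * (\sum_j A i j * w j).
  rewrite -devE -bm_intZ; last exact: bm_dev.
  rewrite -bm_intD//; last by apply: bmM; [exact: bm_cst|exact: bm_dev].
  rewrite /w gibbs_mean -{1}(int_cst nu (u i)) -bm_intB; [|exact: bm_cond_mean|exact: bm_cst].
  by apply: eq_Rintegral => b _; rewrite /rem subrK.
have pt i : w i ^+ 2 <= (1 - rho)^-1 * r i ^+ 2 +
    rho^-1 * (\sum_j A i j * w j) ^+ 2.
  rewrite {1}wE (le_trans (sqrD_weighted _ _ rho0 rho1))// [_^-1 * _]mulrC lerD2l.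
  rewrite [leRHS]mulrC ler_pM2r ?invr_gt0// exprMn ler_piMl ?sqr_ge0//.
  have /andP[d0 d1] := tilt_var01 mu (d i) (c i + s i).
  by rewrite -/(D i) in d0 d1 *; rewrite expr2 mulr_ile1.
have := ler_sum (index_enum 'I_p) (fun i (_ : true) => pt i).
rewrite big_split /= -!mulr_sumr.
set S := \sum_i w i ^+ 2; set W := \sum_i r i ^+ 2.
set Y := \sum_i (\sum_j _) ^+ 2 => h.
have hY : rho^-1 * Y <= rho * S.
  by rewrite ler_pdivrMl// mulrA -expr2; exact: l2rho.
have hS : S <= W / (1 - rho) ^+ 2.
  rewrite ler_pdivlMr ?exprn_gt0//.
  rewrite expr2 mulrA -ler_pdivlMr// [leRHS]mulrC; lra.
have hW : W <= 144 * (p%:R * (92 * (438 * al) ^+ 2) / (1 - rho) ^+ 4).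
  rewrite (le_trans (ler_sum _ (fun i _ => r2 i)))// -mulr_sumr ler_pM2l//.
rewrite -/S; apply: (le_trans hS).
rewrite ler_pdivrMr ?exprn_gt0//; apply: (le_trans hW).
rewrite le_eqVlt; apply/orP; left; apply/eqP.
by field; rewrite gt_eqF.
Qed.

End Gibbs.

(** * Relative entropy *)

Section DensityProbability.
Context d (T : measurableType d) (R : realType).
Variables (mu : probability T R) (f : T -> R).
Hypotheses (mf : measurable_fun setT f) (f0 : forall x, 0 <= f x).
Hypothesis f1 : (\int[mu]_x (f x)%:E = 1)%E.

Definition density_prob (B : set T) : \bar R := (\int[mu]_(x in B) (f x)%:E)%E.

Let density_prob0 : density_prob set0 = 0%E.
Proof. by rewrite /density_prob integral_set0. Qed.

Let density_prob_ge0 B : (0 <= density_prob B)%E.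
Proof. by apply: integral_ge0 => x _; rewrite lee_fin. Qed.

Let density_prob_sigma_additive : semi_sigma_additive density_prob.
Proof.
move=> B mB tB mUB; rewrite /density_prob ge0_integral_bigcup//.
- apply: is_cvg_ereal_nneg_natsum_cond => k _ _.
  by apply: integral_ge0 => x _; rewrite lee_fin.
- by apply/measurable_funTS/measurable_EFinP.
- by move=> x _; rewrite lee_fin.
Qed.

HB.instance Definition _ := isMeasure.Build _ _ _ density_prob
  density_prob0 density_prob_ge0 density_prob_sigma_additive.

HB.instance Definition _ := Measure_isProbability.Build _ _ _ density_prob f1.

(** Supplies the tilted law that competes with a factor of the minimizer. *)
Lemma density_prob_exists : exists nu : probability T R, density_of nu mu f.
Proof. by exists density_prob. Qed.

End DensityProbability.

Section Divergence.
Context d (T : measurableType d) (R : realType).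
Implicit Types (mu nu Q : probability T R) (f g : T -> R).
Local Open Scope ereal_scope.

(** Any version of the density may be used: two versions agree [nu]-almost everywhere, hence
    [Q]-almost everywhere by domination. *)
Lemma KL_density Q nu f : density_of Q nu f -> KL Q nu = \int[Q]_x (ln (f x))%:E.
Proof.
move=> df; have Qnu := density_dominates df; have [mf f0 _] := df.
rewrite /KL; case: asboolP => // _.
have mRN : measurable_fun setT (Radon_Nikodym (charge_of_finite_measure Q) nu).
  by [].
apply: ae_eq_integral => //.
- apply/measurable_EFinP; apply: measurableT_comp; first exact: measurable_ln.
  exact: measurableT_comp.
- by apply/measurable_EFinP; apply: measurableT_comp => //; exact: measurable_ln.
- apply: (null_dominates_ae_eq measurableT Qnu).
  by apply: filterS (density_RN df) => x + /= _ => /(_ I) <-.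
Qed.

(* Jensen, with the strictness of [1 + x <= expR x] giving the equality case. *)
Lemma gibbs_inequality_eq Q P mu f g :
  density_of Q mu f -> density_of P mu g -> (forall x, 0 < g x)%R ->
  Q.-integrable setT (fun x => (ln (f x) - ln (g x))%:E) ->
  (\int[Q]_x (ln (f x) - ln (g x)) <= 0)%R ->
  forall A, measurable A -> Q A = P A.
Proof.
move=> dQ dP g0 intl le0.
have [mf f0 QE] := dQ; have [mg _ PE] := dP.
pose l x := (ln (f x) - ln (g x))%R.
have ml : measurable_fun setT l.
  by apply: measurable_funB; apply: measurableT_comp => //; exact: measurable_ln.
pose w x := expR (- l x).
have mw : measurable_fun setT w.
  by apply: measurableT_comp => //; exact: measurableT_comp.
(* Where [f > 0] this is an equality, since [w = g / f]. Where [f = 0] the default value of [ln]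
   enters [w], but the left side vanishes. *)
have wf x : (w x * f x <= g x)%R.
  have [fx0|fx0] := eqVneq (f x) 0%R; first by rewrite fx0 mulr0 ltW.
  have fxp : (0 < f x)%R by rewrite lt0r fx0 f0.
  rewrite /w /l opprB expRD expRN !lnK ?posrE//.
  by rewrite mulrVK// unitfE.
have Qw B : measurable B -> \int[Q]_(x in B) (w x)%:E <= P B.
  move=> mB; rewrite PE// integral_mkcond.
  rewrite (density_integral dQ); last 2 first.
  - apply/(measurable_restrictT _ mB); apply: measurable_funTS.
    exact/measurable_EFinP.
  - move=> x; rewrite patchE; case: ifP => // _; rewrite lee_fin; exact: expR_ge0.
  rewrite [leRHS]integral_mkcond; apply: ge0_le_integral => //.
  - by move=> x _; rewrite patchE; case: ifP; rewrite ?mul0e// -EFinM lee_fin mulr_ge0// expR_ge0.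
  - apply: emeasurable_funM; last exact/measurable_EFinP.
    apply/(measurable_restrictT _ mB); apply: measurable_funTS.
    exact/measurable_EFinP.
  - apply/(measurable_restrictT _ mB); apply: measurable_funTS.
    exact/measurable_EFinP.
  - move=> x _; rewrite !patchE; case: ifP => _; last by rewrite mul0e.
    by rewrite -EFinM lee_fin.
have intw : Q.-integrable setT (EFin \o w).
  apply/integrableP; split; first exact/measurable_EFinP.
  under eq_integral do rewrite /= ger0_norm ?expR_ge0//.
  apply: (le_lt_trans (Qw _ measurableT)).
  by rewrite (@probability_setT _ _ _ P) ltry.
(* Nonnegative, with [Q]-integral at most [1 - 1 + 0]; so it vanishes almost everywhere, and
   strictness forces [w = 1]. *)
pose phi x := (w x - 1 + l x)%R.
have phi0 x : (0 <= phi x)%R.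
  by have := expR_ge1Dx (- l x); rewrite /phi /w; lra.
have int1 : Q.-integrable setT (EFin \o cst 1%R).
  exact: bm_integrable (@bm_cst _ _ _ _).
have intphi : \int[Q]_x (phi x)%:E = 0.
  apply/eqP; rewrite eq_le integral_ge0 ?andbT; last by move=> x _; rewrite lee_fin.
  have intw1 : Q.-integrable setT (EFin \o (fun x => w x - 1)%R).
    exact: (integrableB measurableT intw int1).
  rewrite integralD_EFin// integralB_EFin//.
  have -> : \int[Q]_x (cst 1%R x)%:E = 1.
    by have := integral_cst Q measurableT 1%E; rewrite /= (@probability_setT _ _ _ Q) mule1.
  have W1 := Qw _ measurableT; rewrite (@probability_setT _ _ _ P) in W1.
  have lf : \int[Q]_x (l x)%:E = (\int[Q]_x l x)%:E.
    by rewrite /Rintegral fineK//; exact: integrable_fin_num intl.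
  have wfin : \int[Q]_x (w x)%:E = (\int[Q]_x w x)%:E.
    by rewrite /Rintegral fineK//; exact: integrable_fin_num intw.
  rewrite wfin lee_fin in W1; rewrite lf wfin -EFinB -EFinD lee_fin.
  by move: le0; rewrite -/(l _) => le0; lra.
have mphi : measurable_fun setT phi by apply: measurable_funD => //; exact: measurable_funB.
have w1 : {ae Q, forall x, w x = 1%R}.
  have mphiE : measurable_fun setT (EFin \o phi) by exact/measurable_EFinP.
  have := (ae_eq_integral_abs Q measurableT mphiE).1.
  under eq_integral do rewrite /= ger0_norm//.
  move=> /(_ intphi); apply: filterS => x /(_ I) /= [].
  rewrite /phi /w => h.
  have [->|lx] := eqVneq (l x) 0%R; first by rewrite oppr0 expR0.
  have : (1 + - l x < expR (- l x))%R by rewrite expR_gt1Dx// oppr_eq0.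
  lra.
(* A one-sided comparison suffices: applied to the complement as well, it yields equality because
   both total masses are 1. *)
have QP B : measurable B -> Q B <= P B.
  move=> mB; rewrite -[Q B]mul1e -integral_cst// (le_trans _ (Qw _ mB))//.
  rewrite le_eqVlt; apply/orP; left; apply/eqP; apply: ae_eq_integral => //.
    by apply: measurable_funTS; exact/measurable_EFinP.
  by apply: filterS w1 => x /= -> _.
move=> A mA; apply/eqP; rewrite eq_le QP//=.
have := QP _ (measurableC mA).
rewrite !probability_setC// -(fineK (fin_num_measure Q A mA)).
rewrite -(fineK (fin_num_measure P A mA)) -!EFinB !lee_fin.
by rewrite lerD2l lerN2.
Qed.

End Divergence.

Section LogDensity.
Context d (T : measurableType d) (R : realType).
Implicit Types (Q mu : probability T R) (f g : T -> R).
Local Open Scope ereal_scope.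

(** Under [mu] the integrand becomes [f] times the negative part of [ln f], which is at most 1
    because [ln (1 / f) <= 1 / f]. So only the positive part of an entropy can be infinite. *)
Lemma integral_neg_ln_density Q mu f : density_of Q mu f ->
  \int[Q]_x (Num.max 0 (- ln (f x)))%:E <= 1.
Proof.
move=> df; have [mf f0 _] := df.
have mneg : measurable_fun setT (fun x => Num.max 0 (- ln (f x)))%R.
  apply: measurable_maxr => //; apply: measurableT_comp => //.
  by apply: measurableT_comp => //; exact: measurable_ln.
rewrite (density_integral df); last 2 first.
- exact/measurable_EFinP.
- by move=> x; rewrite lee_fin le_max lexx.
have <- : \int[mu]_x (cst 1 x) = 1.
  by have := integral_cst mu measurableT 1%E; rewrite /= (@probability_setT _ _ _ mu) mule1.
apply: ge0_le_integral => //.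
- by move=> x _; rewrite -EFinM lee_fin mulr_ge0// le_max lexx.
- by apply: emeasurable_funM; exact/measurable_EFinP.
move=> x _; rewrite -EFinM lee_fin.
have [fx0|fx0] := eqVneq (f x) 0%R; first by rewrite fx0 mulr0.
have fxp : (0 < f x)%R by rewrite lt0r fx0 f0.
rewrite -ler_pdivlMr// ge_max divr_ge0//= -lnV//.
have := expR_ge1Dx (ln (f x)^-1); rewrite lnK ?posrE ?invr_gt0// div1r.
lra.
Qed.

Lemma integrable_of_lower_bound (Q : probability T R) f g : measurable_fun setT f ->
  Q.-integrable setT (EFin \o g) -> (forall x, - g x <= f x)%R ->
  \int[Q]_x (f x)%:E < +oo -> Q.-integrable setT (EFin \o f).
Proof.
move=> mf ig gf foo.
have mfE : measurable_fun setT (EFin \o f) by exact/measurable_EFinP.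
have [mg goo] := integrableP _ _ _ ig.
have neg : \int[Q]_x ((EFin \o f)^\- x) < +oo.
  apply: le_lt_trans goo; apply: ge0_le_integral => //.
  - exact: measurable_funeneg.
  - exact: measurableT_comp.
  move=> x _; rewrite funenegE ge_max abse_ge0 andbT lee_fin.
  by rewrite lerNl (le_trans _ (gf x))// lerN2 ler_norm.
have negfin : \int[Q]_x ((EFin \o f)^\- x) \is a fin_num.
  by rewrite ge0_fin_numE// integral_ge0.
apply/integrableP; split => //.
have -> : (fun x => `|(EFin \o f) x|) = (EFin \o f)^\+ \+ (EFin \o f)^\-.
  by rewrite -fune_abse.
rewrite ge0_integralD//; last 2 first.
- exact: measurable_funepos.
- exact: measurable_funeneg.
rewrite lte_add_pinfty//.
have e : \int[Q]_x (f x)%:E = \int[Q]_x ((EFin \o f)^\+ x) - \int[Q]_x ((EFin \o f)^\- x).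
  exact: (integralE Q setT (EFin \o f)).
move: foo; rewrite e -(fineK negfin).
by move: (\int[Q]_x _^\+ x) (fine _) => [P | |] r //= _; exact: ltry.
Qed.

End LogDensity.

(** * Divergence of a product measure from a Gibbs measure *)

Section MeanField.
Context {R : realType} (p : nat).
Local Notation T := (p.-tuple (Rmeas R)).
Variables (mu : probability (Rmeas R) R) (A : 'I_p -> 'I_p -> R) (c d : 'I_p -> R).
Variables (V : T -> R) (nu : probability T R).
Hypothesis bV : bounded_measurable V.
Hypothesis nuV : density_of nu (prod_prob (fun=> mu)) (fun b => expR (V b)).
Hypothesis Vupd : forall b i z, V (upd i b z) =
  V (upd i b 0) + ((c i + local_field A i b) * clip z - d i / 2 * clip z ^+ 2).
Hypothesis A0 : forall i, A i i = 0.
Implicit Types Q : 'I_p -> probability (Rmeas R) R.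
Implicit Types f : 'I_p -> R -> R.

Local Open Scope ereal_scope.

Lemma measurable_sum_ln f : (forall i, measurable_fun setT (f i)) ->
  measurable_fun setT (fun b : T => \sum_i ln (f i (tnth b i)))%R.
Proof.
move=> mf; apply: measurable_sum => i; apply: measurableT_comp; first exact: measurable_ln.
exact: (measurableT_comp (mf i) (measurable_tnth i)).
Qed.

Lemma density_prod_gibbs Q f : (forall i, density_of (Q i) mu (f i)) ->
  density_of (prod_prob Q) nu (fun b => (\prod_i f i (tnth b i)) * expR (- V b))%R.
Proof.
move=> df; have dP := density_prod_prob (P := fun=> mu) df.
have mV := bm_measurable bV.
have mE : measurable_fun setT (fun b => expR (- V b)).
  by apply: measurableT_comp => //; exact: measurableT_comp.
have [mF F0 _] := dP.
apply: density_intro.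
- exact: measurable_funM.
- by move=> b; rewrite mulr_ge0// expR_ge0.
move=> phi mphi phi0.
rewrite (density_integral dP)// (density_integral nuV); last 2 first.
- by apply: emeasurable_funM => //; apply/measurable_EFinP; exact: measurable_funM.
- by move=> b; rewrite mule_ge0// lee_fin mulr_ge0// expR_ge0.
apply: eq_integral => b _; rewrite -muleA -EFinM -mulrA -expRD addNr expR0 mulr1//.
Qed.

Lemma KL_prod_gibbs Q f : (forall i, density_of (Q i) mu (f i)) ->
  KL (prod_prob Q) nu =
  \int[prod_prob Q]_b ((\sum_i ln (f i (tnth b i))) - V b)%:E.
Proof.
move=> df; have dQ := density_prod_gibbs df; have mV := bm_measurable bV.
have mf i : measurable_fun setT (f i) by case: (df i).
rewrite (KL_density dQ); apply: ae_eq_integral => //.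
- apply/measurable_EFinP; apply: measurableT_comp; first exact: measurable_ln.
  by case: dQ.
- by apply/measurable_EFinP; apply: measurable_funB => //; exact: measurable_sum_ln.
(* The logarithm of the product splits into a sum only where every factor is positive. *)
have pos i : {ae prod_prob Q, forall b, (0 < f i (tnth b i))%R}.
  exact: (prod_prob_ae_marginal (A := [set z | 0 < f i z]%R) (density_ae_gt0 (df i))).
apply: filterS (ae_forall_ord pos) => b bpos _ /=.
congr EFin; rewrite lnM ?posrE ?expR_gt0 ?prodr_gt0// expRK.
congr (_ + _)%R.
suff : forall s : seq 'I_p, ((0 < \prod_(i <- s) f i (tnth b i))%R /\
    ln (\prod_(i <- s) f i (tnth b i)) = \sum_(i <- s) ln (f i (tnth b i)))%R.
  by move=> /(_ (index_enum _)) [].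
elim=> [|i s [IH1 IH2]]; first by rewrite !big_nil ln1.
by rewrite !big_cons mulr_gt0// lnM ?posrE// IH2.
Qed.

Lemma prod_prob_dominates Q : prod_prob Q `<< nu -> forall i, Q i `<< mu.
Proof.
move=> Qnu i; apply/null_content_dominatesP => B mB muB.
have dom := null_dominates_trans Qnu (density_dominates nuV).
rewrite -(prod_prob_marginal Q i mB).
have mB' : measurable [set b : T | B (tnth b i)].
  rewrite -[X in measurable X]setTI; exact: (@measurable_tnth _ _ _ i).
move/null_content_dominatesP : dom; apply => //.
exact: (etrans (prod_prob_marginal (fun=> mu) i mB)).
Qed.

(** Changing factor [i] is invisible to functions that ignore coordinate [i]. No integrability is
    assumed, so the lemma can itself transfer integrability from [Q] to [Q']. *)
Lemma integral_indep_coord Q Q' i (phi : T -> \bar R) :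
  (forall j, j != i -> Q' j = Q j) -> measurable_fun setT phi ->
  (forall b z, phi (upd i b z) = phi b) ->
  \int[prod_prob Q']_b phi b = \int[prod_prob Q]_b phi b.
Proof.
move=> QQ' mphi phiupd.
have key (psi : T -> \bar R) : measurable_fun setT psi -> (forall b, 0 <= psi b) ->
    (forall b z, psi (upd i b z) = psi b) ->
    \int[prod_prob Q']_b psi b = \int[prod_prob Q]_b psi b.
  move=> mpsi psi0 psiupd; rewrite (integral_resample QQ')//.
  apply: eq_integral => b _.
  transitivity (\int[Q' i]_z (cst (psi b) z)).
    by apply: eq_integral => z _; rewrite psiupd.
  by rewrite integral_cst//= (@probability_setT _ _ _ (Q' i)) mule1.
rewrite integralE [RHS]integralE !key//.
- exact: measurable_funeneg.
- by move=> b z; rewrite !funenegE phiupd.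
- exact: measurable_funepos.
- by move=> b z; rewrite !funeposE phiupd.
Qed.

(** The negative parts [N i] of all the logarithms are integrable and [V] is bounded, so finite KL
    makes the whole integrand [Lam] integrable. One logarithm is then at most [Lam] plus the
    negative parts of the others plus a constant, so its positive part cannot diverge. *)
Lemma integrable_ln_density Q f : (forall i, density_of (Q i) mu (f i)) ->
  KL (prod_prob Q) nu < +oo ->
  forall i, (prod_prob Q).-integrable setT (EFin \o (fun b => ln (f i (tnth b i)))).
Proof.
move=> df; rewrite (KL_prod_gibbs df) => KLoo.
have mf i : measurable_fun setT (f i) by case: (df i).
have mL i : measurable_fun setT (fun b : T => ln (f i (tnth b i))).
  apply: measurableT_comp; first exact: measurable_ln.
  exact: (measurableT_comp (mf i) (measurable_tnth i)).
pose N i (b : T) : R := Num.max 0%R (- ln (f i (tnth b i)))%R.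
have mN i : measurable_fun setT (N i).
  by apply: measurable_maxr => //; exact: measurableT_comp.
have N0 i b : (0 <= N i b)%R by rewrite le_max lexx.
have iN i : (prod_prob Q).-integrable setT (EFin \o N i).
  apply/integrableP; split; first exact/measurable_EFinP.
  under eq_integral do rewrite /= ger0_norm//.
  rewrite (integral_marginal Q i (g := fun z => (Num.max 0 (- ln (f i z)))%:E)).
  - by rewrite (le_lt_trans (integral_neg_ln_density (df i)))// ltry.
  - apply/measurable_EFinP; apply: measurable_maxr => //.
    exact: (measurable_funN (measurableT_comp (@measurable_ln R) (mf i))). 
  - by move=> z; rewrite lee_fin le_max lexx.
have [mV [M VM]] := bV.
pose G b : R := (\sum_i N i b + M)%R.
have iM : (prod_prob Q).-integrable setT (EFin \o (fun=> M)).
  exact: bm_integrable (@bm_cst _ _ _ _).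
have iSN : (prod_prob Q).-integrable setT (EFin \o (fun b => \sum_i N i b)%R).
  rewrite (_ : _ \o _ = fun b => \sum_i (N i b)%:E).
    by apply: (integrable_sum measurableT) => i _; exact: iN.
  by apply/funext => b; rewrite /= sumEFin.
have iG : (prod_prob Q).-integrable setT (EFin \o G).
  exact: (integrableD measurableT iSN iM).
have NL i b : (- N i b <= ln (f i (tnth b i)))%R.
  by rewrite lerNl le_max lexx orbT.
pose Lam b : R := (\sum_i ln (f i (tnth b i)) - V b)%R.
have iLam : (prod_prob Q).-integrable setT (EFin \o Lam).
  apply: (integrable_of_lower_bound (g := G)) => //.
    by apply: measurable_funB => //; exact: measurable_sum_ln.
  move=> b; rewrite /G /Lam opprD lerD//.
    by rewrite -sumrN; apply: ler_sum => i _; exact: NL.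
  by rewrite lerN2 (le_trans (ler_norm _)).
move=> i.
have iGG : (prod_prob Q).-integrable setT (EFin \o (fun b => `|Lam b| + (G b + G b))%R).
  have iA := integrable_norm iLam.
  exact: (integrableD measurableT iA (integrableD measurableT iG iG)).
apply: (le_integrable measurableT _ _ iGG); first exact/measurable_EFinP.
move=> b _; rewrite /= lee_fin.
have M0 : (0 <= M)%R by rewrite (le_trans _ (VM b)).
have G0 : (0 <= G b)%R by rewrite addr_ge0// sumr_ge0.
rewrite [leRHS]ger0_norm; last by rewrite addr_ge0// (addr_ge0 G0 G0).
have NG : (N i b <= G b)%R.
  by rewrite /G (bigD1 i)//= -addrA lerDl addr_ge0// sumr_ge0.
have LG : (ln (f i (tnth b i)) <= Lam b + (G b + G b))%R.
  have : (0 <= \sum_(j | j != i) (ln (f j (tnth b j)) + N j b))%R.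
    by apply: sumr_ge0 => j _; rewrite -lerBlDr sub0r.
  rewrite big_split /= /Lam /G.
  have -> : (\sum_j ln (f j (tnth b j)) = ln (f i (tnth b i)) +
    \sum_(j | j != i) ln (f j (tnth b j)))%R by rewrite (bigD1 i).
  have -> : (\sum_j N j b = N i b + \sum_(j | j != i) N j b)%R by rewrite (bigD1 i).
  have := VM b; rewrite ler_norml => /andP[_ Vb].
  have S0 : (0 <= \sum_(j | j != i) N j b)%R by apply: sumr_ge0.
  have := N0 i b; lra.
have := NL i b; have := ler_norm (Lam b); have := normr_ge0 (Lam b).
rewrite ler_norml; lra.
Qed.

End MeanField.

(** * The mean-field fixed point *)

Section TiltProbability.
Context {R : realType}.
Variables (mu : probability (Rmeas R) R) (d t : R).

Definition tilt_density (z : R) : R := tilt_weight d t z / tilt_mass mu d t.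

Lemma bm_tilt_density : @bounded_measurable _ (Rmeas R) R tilt_density.
Proof. by apply: bmM; [exact: bm_tilt_weight|exact: bm_cst]. Qed.

Lemma bm_tilt_exponent :
  @bounded_measurable _ (Rmeas R) R (fun z => t * clip z - d / 2 * clip z ^+ 2).
Proof.
apply: bmB; (apply: bmM; first exact: bm_cst); last apply: bmX; exact: bm_clip.
Qed.

Lemma tilt_density_gt0 z : 0 < tilt_density z.
Proof. by rewrite divr_gt0 ?expR_gt0// tilt_mass_gt0. Qed.

Lemma ln_tilt_density z : ln (tilt_density z) =
  t * clip z - d / 2 * clip z ^+ 2 - ln (tilt_mass mu d t).
Proof. by rewrite ln_div ?posrE ?tilt_mass_gt0 ?expR_gt0// expRK. Qed.

Lemma tilt_prob_exists :
  exists P : probability (Rmeas R) R, density_of P mu tilt_density.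
Proof.
apply: density_prob_exists.
- exact: bm_measurable bm_tilt_density.
- by move=> z; rewrite ltW// tilt_density_gt0.
rewrite (bm_EFin _ bm_tilt_density); congr EFin.
rewrite /tilt_density.
under eq_Rintegral do rewrite mulrC.
rewrite bm_intZ; last exact: bm_tilt_weight.
by rewrite -/(tilt_mass mu d t) mulVf// gt_eqF// tilt_mass_gt0.
Qed.

Lemma tilt_prob_mean (P : probability (Rmeas R) R) : density_of P mu tilt_density ->
  \int[P]_z clip z = tilt_mean mu d t.
Proof.
move=> dP; rewrite (bm_density_integral dP); [|exact: bm_tilt_density|exact: bm_clip].
rewrite /tilt_mean /tilt_exp mulrC -bm_intZ; last first.
  by apply: bmM; [exact: bm_clip|exact: bm_tilt_weight].
by apply: eq_Rintegral => z _; rewrite /tilt_density mulrA mulrC.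
Qed.

End TiltProbability.

Lemma supported11_dominated (R : realType) (P mu : probability (Rmeas R) R) :
  P `<< mu -> supported11 mu -> supported11 P.
Proof.
move=> /null_content_dominatesP Pmu mu1; rewrite /supported11.
pose B : set (Rmeas R) := `[(-1 : R), 1]%classic.
have mB : measurable B by exact: measurable_itv.
have muB : mu B = 1%E by [].
have : P (~` B) = 0%E.
  apply: Pmu; first exact: measurableC.
  have e : mu (~` B) = (1 - mu B)%E by exact: probability_setC.
  by apply: (etrans e); rewrite muB subee.
have -> : P (~` B) = (1 - P B)%E by exact: probability_setC.
rewrite -[P `[_, _]%classic]/(P B) -(fineK (fin_num_measure P _ mB)) -EFinB => -[/eqP].
by rewrite subr_eq0 => /eqP <-.
Qed.

Lemma integral_marginal_measurable (R : realType) p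
    (P : 'I_p -> probability (Rmeas R) R) (i : 'I_p) (g : Rmeas R -> \bar R) :
  measurable_fun setT g ->
  (\int[prod_prob P]_b g (tnth b i) = \int[P i]_z g z)%E.
Proof.
move=> mg; rewrite integralE [RHS]integralE; congr (_ - _)%E.
- rewrite -(integral_marginal P i (measurable_funepos mg))//.
  by apply: eq_integral => b _; rewrite !funeposE.
- rewrite -(integral_marginal P i (measurable_funeneg mg))//.
  by apply: eq_integral => b _; rewrite !funenegE.
Qed.

Section MeanFieldFixpoint.
Context {R : realType} (p : nat).
Local Notation T := (p.-tuple (Rmeas R)).
Variables (mu : probability (Rmeas R) R) (A : 'I_p -> 'I_p -> R) (c d : 'I_p -> R).
Variables (V : T -> R) (nu : probability T R).
Hypothesis bV : bounded_measurable V.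
Hypothesis nuV : density_of nu (prod_prob (fun=> mu)) (fun b => expR (V b)).
Hypothesis Vupd : forall b i z, V (upd i b z) =
  V (upd i b 0) + ((c i + local_field A i b) * clip z - d i / 2 * clip z ^+ 2).
Implicit Types Q : 'I_p -> probability (Rmeas R) R.
Implicit Types f : 'I_p -> R -> R.

(** The coefficient of coordinate [i] in [V] is affine in the local field, and under a product
    measure only its mean enters. The first term does not involve [Q' i], so it cancels between [Q]
    and a competitor with another [i]-th factor. *)
Lemma potential_resample Q Q' i : (forall j, j != i -> Q' j = Q j) ->
  let t := c i + \sum_j A i j * \int[Q j]_z clip z in
  \int[prod_prob Q']_b V b = \int[prod_prob Q]_b V (upd i b 0) +
    \int[Q' i]_z (t * clip z - d i / 2 * clip z ^+ 2).
Proof.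
move=> QQ' t; rewrite (bm_int_resample QQ')//.
have bc := @bm_clip R.
have b2 : @bounded_measurable _ (Rmeas R) R (fun z => d i / 2 * clip z ^+ 2).
  by apply: bmM; [exact: bm_cst|exact: bmX].
have bl s : @bounded_measurable _ (Rmeas R) R (fun z => s * clip z).
  by apply: bmM => //; exact: bm_cst.
have bV0 : bounded_measurable (fun b => V (upd i b 0)).
  have [mV [M VM]] := bV; split; last by exists M => b; exact: (VM (upd i b 0)).
  exact: (measurableT_comp mV (measurable_updl i 0)).
pose r := \int[Q' i]_z clip z; pose k := \int[Q' i]_z (d i / 2 * clip z ^+ 2).
have inner b : \int[Q' i]_z V (upd i b z) =
    V (upd i b 0) + ((c i + local_field A i b) * r - k).
  under eq_Rintegral do rewrite Vupd.
  rewrite bm_intD; [|exact: bm_cst|exact: bmB].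
  by rewrite int_cst bm_intB// bm_intZ.
under eq_Rintegral do rewrite inner.
have blf := bm_local_field A i.
have bin : bounded_measurable (fun b : T => (c i + local_field A i b) * r).
  by apply: bmM; [apply: bmD => //; exact: bm_cst|exact: bm_cst].
rewrite bm_intD//; last by apply: bmB => //; exact: bm_cst.
rewrite bm_intB//; last exact: bm_cst.
rewrite int_cst bm_intB// bm_intZ// -/r -/k; congr (_ + (_ - _)).
under eq_Rintegral do rewrite mulrC.
rewrite bm_intZ; last by apply: bmD => //; exact: bm_cst.
rewrite bm_intD//; last exact: bm_cst.
rewrite int_cst mulrC; congr ((_ + _) * _).
rewrite bm_int_sum; last by move=> j; apply: bmM; [exact: bm_cst|exact: bm_xc].
apply: eq_bigr => j _; rewrite bm_intZ; last exact: bm_xc.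
by rewrite -(@bm_int_marginal _ _ Q j clip).
Qed.

Lemma KL_prod_gibbs_fin Q f : (forall i, density_of (Q i) mu (f i)) ->
  (forall i, (prod_prob Q).-integrable setT (EFin \o (fun b => ln (f i (tnth b i))))) ->
  KL (prod_prob Q) nu =
  (\sum_i \int[prod_prob Q]_b ln (f i (tnth b i)) - \int[prod_prob Q]_b V b)%:E.
Proof.
move=> df iL; rewrite (KL_prod_gibbs bV nuV df).
have iS : (prod_prob Q).-integrable setT
    (EFin \o (fun b => \sum_i ln (f i (tnth b i)))).
  rewrite (_ : _ \o _ = fun b => (\sum_i (ln (f i (tnth b i)))%:E)%E).
    by apply: (integrable_sum measurableT) => i _; exact: iL.
  by apply/funext => b; rewrite /= sumEFin.
have iV := bm_integrable (prod_prob Q) bV.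
rewrite integralB_EFin// EFinB; congr (_ - _)%E; last exact: bm_EFin.
rewrite -sumEFin.
transitivity (\int[prod_prob Q]_b (\sum_i (ln (f i (tnth b i)))%:E))%E.
  by apply: eq_integral => b _; rewrite sumEFin.
rewrite integral_sum//; apply: eq_bigr => i _.
by rewrite /Rintegral fineK//; exact: integrable_fin_num (iL i).
Qed.

Hypothesis mu_supp : supported11 mu.

Lemma density_of_self : density_of mu mu (fun=> 1).
Proof.
by split => // B mB; rewrite integral_cst// mul1e.
Qed.

Lemma mean_field_fixpoint Q : mean_field_approx nu Q -> forall i,
  let u j := \int[Q j]_z clip z in
  u i = cond_mean mu c d i (\sum_j A i j * u j).
Proof.
move=> [Qsupp Qmin] i u.
(* The prior has density 1 and a bounded potential, so its divergence is finite. This makes the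
   minimum finite and each [Q j] absolutely continuous. *)
have Qprior : (KL (prod_prob Q) nu <= KL (prod_prob (fun=> mu)) nu)%E by exact: Qmin.
have KLoo : (KL (prod_prob Q) nu < +oo)%E.
  apply: (le_lt_trans Qprior).
  rewrite (@KL_prod_gibbs_fin (fun=> mu) (fun _ _ => 1)) ?ltry//.
    by move=> j; exact: density_of_self.
  by move=> j; exact: bm_integrable (@bm_cst _ _ _ _).
have Qnu : prod_prob Q `<< nu.
  by move: KLoo; rewrite /KL; case: asboolP.
have /choice[f df] : forall j, exists fj, density_of (Q j) mu fj.
  by move=> j; apply: density_exists; exact: (prod_prob_dominates nuV Qnu j).
have iL := integrable_ln_density bV nuV df KLoo.
pose t := c i + \sum_j A i j * u j.
have [P dP] := tilt_prob_exists mu (d i) t.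
set g := tilt_density mu (d i) t in dP.
pose Q' j := if j == i then P else Q j.
pose f' j := if j == i then g else f j.
have QQ' j : j != i -> Q' j = Q j by rewrite /Q' => /negbTE ->.
have Q'i : Q' i = P by rewrite /Q' eqxx.
have f'i : f' i = g by rewrite /f' eqxx.
have df' j : density_of (Q' j) mu (f' j).
  by rewrite /Q' /f'; case: eqP.
have blng : @bounded_measurable _ (Rmeas R) R (fun z => ln (g z)).
  rewrite (_ : (fun z => _) = fun z => t * clip z - d i / 2 * clip z ^+ 2
    - ln (tilt_mass mu (d i) t)); last first.
    by apply/funext => z; exact: ln_tilt_density.
  by apply: bmB; [exact: bm_tilt_exponent|exact: bm_cst].
have mL j : measurable_fun setT (EFin \o (fun b : T => ln (f j (tnth b j)))).
  exact: measurable_int (iL j).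
have Lupd j b z : j != i -> ln (f j (tnth (upd i b z) j)) = ln (f j (tnth b j)).
  by move=> /negbTE ji; rewrite tnth_upd ji.
have iL' j : (prod_prob Q').-integrable setT (EFin \o (fun b => ln (f' j (tnth b j)))).
  rewrite /f'; have [->|ji] := eqVneq j i.
    apply: bm_integrable; case: blng => mg [M gM]; split.
      exact: (measurableT_comp mg (measurable_tnth i)).
    by exists M => b; exact: gM.
  apply/integrableP; split; first exact: mL.
  rewrite (integral_indep_coord (Q := Q) (i := i) QQ').
  - by have /integrableP[] := iL j.
  - exact: measurableT_comp.
  - by move=> b z; rewrite /= Lupd.
have := Qmin Q'; rewrite (KL_prod_gibbs_fin df iL) (KL_prod_gibbs_fin df' iL').
have Q'supp j : supported11 (Q' j).
  rewrite /Q'; case: eqP => // _; apply: supported11_dominated mu_supp.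
  exact: density_dominates dP.
move=> /(_ Q'supp); rewrite lee_fin.
(* Expanding both potentials around the same frozen term leaves an inequality about factor [i]
   alone. *)
rewrite (@potential_resample Q Q i (fun _ _ => erefl)) -/t.
rewrite (potential_resample QQ') -/t.
rewrite (bigD1 i)//= [\sum_i0 \int[prod_prob Q']_b _](bigD1 i)//=.
have -> : \sum_(j | j != i) \int[prod_prob Q']_b ln (f' j (tnth b j)) =
    \sum_(j | j != i) \int[prod_prob Q]_b ln (f j (tnth b j)).
  apply: eq_bigr => j ji; rewrite /f' (negbTE ji) /Rintegral; congr fine.
  apply: (integral_indep_coord QQ' (mL j)) => b z.
  by congr EFin; exact: Lupd.
rewrite f'i (@bm_int_marginal _ _ Q' i (fun z => ln (g z)))// Q'i.
pose l z := t * clip z - d i / 2 * clip z ^+ 2.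
have bl : @bounded_measurable _ (Rmeas R) R l by exact: bm_tilt_exponent.
have lng (P' : probability (Rmeas R) R) : \int[P']_z ln (g z) = \int[P']_z l z - ln (tilt_mass mu (d i) t).
  rewrite -(int_cst P' (ln (tilt_mass _ _ _))) -bm_intB//; last exact: bm_cst.
  by apply: eq_Rintegral => z _; exact: ln_tilt_density.
rewrite lng -/(l _) => ineq.
have iLi : (Q i).-integrable setT (EFin \o (fun z => ln (f i z))).
  apply/integrableP; split.
    apply/measurable_EFinP; apply: measurableT_comp; first exact: measurable_ln.
    by case: (df i).
  have mln : measurable_fun setT (fun z : Rmeas R => (`|ln (f i z)|)%:E).
    apply/measurable_EFinP; apply: measurableT_comp => //.
    by apply: measurableT_comp; [exact: measurable_ln|case: (df i)].
  rewrite -(integral_marginal Q i (g := fun z => (`|ln (f i z)|)%:E))//.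
  by have /integrableP[] := iL i.
have margL : \int[prod_prob Q]_b ln (f i (tnth b i)) = \int[Q i]_z ln (f i z).
  rewrite /Rintegral; congr fine.
  apply: (integral_marginal_measurable Q i (g := fun z => (ln (f i z))%:E)).
  apply/measurable_EFinP; apply: measurableT_comp; first exact: measurable_ln.
  by case: (df i).
(* Since [ln g] is the linear-quadratic exponent [l] minus the log-mass, minimality reads [\int[Q i]
   (ln (f i) - ln g) <= 0]: the relative entropy of [Q i] with respect to the tilt is at most 0. *)
have QP : forall B, measurable B -> Q i B = P B.
  apply: (gibbs_inequality_eq (df i) dP).
  - by move=> z; exact: tilt_density_gt0.
  - exact: (integrableB measurableT iLi (bm_integrable (Q i) blng)).
  - rewrite RintegralB//; last exact: bm_integrable.
    by rewrite lng -margL; lra.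
rewrite /u /cond_mean -/t -(tilt_prob_mean dP) /Rintegral; congr fine.
by apply: eq_measure_integral => B mB _; exact: QP.
Qed.

End MeanFieldFixpoint.

(** * The posterior *)

Lemma supported11_ae (R : realType) (P : probability (Rmeas R) R) :
  supported11 P -> {ae P, forall z : R, clip z = z}.
Proof.
move=> P1; pose B : set (Rmeas R) := `[(-1 : R), 1]%classic.
have mB : measurable B by exact: measurable_itv.
exists (~` B); split; first exact: measurableC.
- have e : P (~` B) = (1 - P B)%E by exact: probability_setC.
  by apply: (etrans e); rewrite [P B]P1 subee.
- move=> z /= + zB; apply; apply: clip_id.
  by move: zB; rewrite /B /= in_itv.
Qed.

Section LinearModel.
Context {R : realType} (n p : nat).
Local Notation T := (p.-tuple (Rmeas R)).

Definition clip_vec (b : T) : 'cV[R]_p := \col_i xc i b.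

Lemma supported11_clip_vec_ae (Q : 'I_p -> probability (Rmeas R) R) :
  (forall i, supported11 (Q i)) -> {ae prod_prob Q, forall b, clip_vec b = vec b}.
Proof.
move=> Q1.
have h i : {ae prod_prob Q, forall b, clip (tnth b i : R) = tnth b i}.
  exact: (prod_prob_ae_marginal (A := [set z : R | clip z = z]) (supported11_ae (Q1 i))).
apply: filterS (ae_forall_ord h) => b hb.
by apply/matrixP => i j; rewrite !mxE; exact: hb.
Qed.

Variables (mu : probability (Rmeas R) R) (s2 : R) (X : 'M[R]_(n, p)) (y : 'cV[R]_n).
Hypotheses (mu_supp : supported11 mu) (s2_gt0 : 0 < s2).

Definition energy (b : T) : R :=
  (\sum_k (y k 0 - \sum_j X k j * xc j b) ^+ 2) / (2 * s2).

Lemma bm_energy : bounded_measurable energy.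
Proof.
apply: bmM; last exact: bm_cst.
apply: bm_sum => k; apply: bmX; apply: bmB; first exact: bm_cst.
by apply: bm_sum => j; apply: bmM; [exact: bm_cst|exact: bm_xc].
Qed.

Lemma likelihood_clip b : clip_vec b = vec b ->
  likelihood s2 X y b = expR (- energy b).
Proof.
move=> h; rewrite /likelihood -h /norm2 sqr_sqrtr; last first.
  by apply: sumr_ge0 => i _; exact: sqr_ge0.
congr expR; congr (- (_ / _)); apply: eq_bigr => k _.
rewrite !mxE; congr ((_ - _) ^+ 2); apply: eq_bigr => j _.
by rewrite mxE.
Qed.

Local Notation prior := (prod_prob (fun _ : 'I_p => mu)).

Definition evidence : R := \int[prior]_b expR (- energy b).

Lemma bm_boltzmann : bounded_measurable (fun b => expR (- energy b)).
Proof. by apply: bm_expR; apply: bmN; exact: bm_energy. Qed.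

Lemma evidence_gt0 : 0 < evidence.
Proof.
have [_ [M EM]] := bm_energy.
apply: (@lt_le_trans _ _ (expR (- M))); first exact: expR_gt0.
rewrite -(int_cst prior (expR (- M))).
apply: bm_int_le; [exact: bm_cst|exact: bm_boltzmann|].
by move=> b; rewrite ler_expR lerN2 (le_trans (ler_norm _)).
Qed.

(** The normalizing constant is absorbed into the exponent, so [expR potential] is the exact
    posterior density and stays bounded. *)
Definition potential (b : T) : R := - energy b - ln evidence.

Lemma bm_potential : bounded_measurable potential.
Proof. by apply: bmB; [apply: bmN; exact: bm_energy|exact: bm_cst]. Qed.

Lemma unnormalized_posteriorE B : measurable B ->
  unnormalized_posterior mu s2 X y B = (\int[prior]_(b in B) (expR (- energy b))%:E)%E.
Proof.
move=> mB; apply: ae_eq_integral => //.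
- by apply: measurable_funTS; apply/measurable_EFinP; exact: measurable_likelihood.
- apply: measurable_funTS; apply/measurable_EFinP; exact: bm_measurable bm_boltzmann.
have := @supported11_clip_vec_ae (fun=> mu) (fun=> mu_supp).
by apply: filterS => b /likelihood_clip -> _.
Qed.

Lemma density_posterior :
  density_of (posterior mu s2 X y) prior (fun b => expR (potential b)).
Proof.
split.
- exact: bm_measurable (bm_expR bm_potential).
- by move=> b; exact: expR_ge0.
move=> B mB.
have ZE : unnormalized_posterior mu s2 X y setT = evidence%:E.
  by rewrite unnormalized_posteriorE// bm_EFin//; exact: bm_boltzmann.
transitivity (unnormalized_posterior mu s2 X y B * (evidence^-1)%:E)%E.
  (* [mnormalize] takes its default when the total mass is 0 or infinite; [ZE] and [evidence_gt0]
     exclude both cases. *)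
  rewrite /posterior /= /mnormalize /= ZE /=.
  by rewrite eqe gt_eqF ?evidence_gt0.
rewrite unnormalized_posteriorE// muleC -ge0_integralZl//; last 2 first.
- apply: measurable_funTS; apply/measurable_EFinP; exact: bm_measurable bm_boltzmann.
- by rewrite lee_fin invr_ge0 ltW// evidence_gt0.
apply: eq_integral => b _; rewrite -EFinM; congr EFin.
by rewrite /potential expRD [expR (- ln _)]expRN lnK ?posrE ?evidence_gt0// mulrC.
Qed.

Definition linear_coef (i : 'I_p) : R := s2^-1 * \sum_k X k i * y k 0.

Lemma Sigma_sum i j : Sigma s2 X i j = s2^-1 * \sum_k X k i * X k j.
Proof. by rewrite !mxE; congr (_ * _); apply: eq_bigr => k _; rewrite mxE. Qed.

(** With [w] the regression residual when coordinate [i] is 0, the squared error is a quadratic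
    polynomial in [clip z]. Its cross term is [c_i] minus the sum of [Sigma i j * xc j b] over
    [j != i], that is, [c_i] plus the local field. *)
Lemma potential_upd b i z : potential (upd i b z) = potential (upd i b 0) +
  ((linear_coef i + local_field (fun i j => Amat s2 X i j) i b) * clip z
   - Sigma s2 X i i / 2 * clip z ^+ 2).
Proof.
have clip0 : clip (0 : R) = 0 by rewrite clip_id//; lra.
pose w k := y k 0 - \sum_j X k j * xc j (upd i b 0).
have wE z' k : y k 0 - \sum_j X k j * xc j (upd i b z') = w k - clip z' * X k i.
  rewrite /w (bigD1 i)//= [in RHS](bigD1 i)//= !xc_upd !eqxx clip0 mulr0 add0r.
  rewrite opprD addrA addrAC mulrC; congr (_ - _ - _).
  by apply: eq_bigr => j /negbTE ji; rewrite !xc_upd ji.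
have grad : s2^-1 * \sum_k w k * X k i =
    linear_coef i + local_field (fun i j => Amat s2 X i j) i b.
  have -> : \sum_k w k * X k i = \sum_k X k i * y k 0 -
      \sum_j (\sum_k X k i * X k j) * xc j (upd i b 0).
    have -> : \sum_j (\sum_k X k i * X k j) * xc j (upd i b 0) =
        \sum_k \sum_j X k i * X k j * xc j (upd i b 0).
      by rewrite exchange_big /=; apply: eq_bigr => j _; rewrite mulr_suml.
    rewrite -sumrB; apply: eq_bigr => k _.
    rewrite /w mulrBl mulrC; congr (_ - _); rewrite mulr_suml.
    by apply: eq_bigr => j _; rewrite mulrAC [X k i * _]mulrC.
  rewrite mulrBr -/(linear_coef i); congr (_ + _).
  rewrite mulr_sumr -sumrN; apply: eq_bigr => j _.
  rewrite mxE xc_upd Sigma_sum [i == j]eq_sym; case: eqP => [_|_].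
    by rewrite clip0 !mulr0 oppr0 mul0r.
  by rewrite mulNr mulrA.
have sq : \sum_k (w k - clip z * X k i) ^+ 2 = \sum_k w k ^+ 2
    - 2 * clip z * (\sum_k w k * X k i) + clip z ^+ 2 * (\sum_k X k i * X k i).
  rewrite !mulr_sumr -sumrB -big_split /=; apply: eq_bigr => k _; ring.
rewrite -grad Sigma_sum /potential /energy.
under eq_bigr do rewrite wE.
rewrite sq.
by field; rewrite gt_eqF.
Qed.

End LinearModel.

(** * Contraction properties of the interaction matrix *)

Section Interaction.
Context {R : realType} (n p : nat).
Variables (s2 : R) (X : 'M[R]_(n, p)).

Lemma Amat_diag i : Amat s2 X i i = 0.
Proof. by rewrite mxE eqxx. Qed.

Lemma Amat_sym i j : Amat s2 X i j = Amat s2 X j i.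
Proof.
rewrite [LHS]mxE [RHS]mxE eq_sym; case: eqP => // _; rewrite !Sigma_sum.
by congr (- (_ * _)); apply: eq_bigr => k _; rewrite mulrC.
Qed.

Lemma Amat_tr : (Amat s2 X)^T = Amat s2 X.
Proof. by apply/matrixP => i j; rewrite mxE Amat_sym. Qed.

Lemma alpha_row i : \sum_j Amat s2 X i j ^+ 2 <= alpha s2 X.
Proof. exact: (le_bigmax _ (fun i => \sum_j Amat s2 X i j ^+ 2)). Qed.

Lemma alpha_ge0 : 0 <= alpha s2 X.
Proof. exact: bigmax_ge_id. Qed.

Variable rho : R.
Hypotheses (rho0 : 0 < rho) (rho1 : rho < 1) (Arho : opnorm4 (Amat s2 X) <= rho).

Lemma Amat_l4 (v : 'I_p -> R) :
  \sum_i (\sum_j Amat s2 X i j * v j) ^+ 4 <= rho ^+ 4 * \sum_i v i ^+ 4.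
Proof.
have := opnorm4_sum_le (\col_i v i) Arho.
under [X in _ <= _ * X]eq_bigr do rewrite mxE.
apply: le_trans; rewrite le_eqVlt; apply/orP; left; apply/eqP.
apply: eq_bigr => i _; rewrite [in RHS]mxE; congr (_ ^+ 4).
by apply: eq_bigr => j _; rewrite [X in _ = _ * X]mxE.
Qed.

Lemma Amat_l2 (v : 'I_p -> R) :
  \sum_i (\sum_j Amat s2 X i j * v j) ^+ 2 <= rho ^+ 2 * \sum_i v i ^+ 2.
Proof.
have := opnorm4_symmetric_l2 (\col_i v i) Amat_tr rho0 Arho.
have dE (w : 'cV[R]_p) : dotv w w = \sum_i w i 0 ^+ 2.
  by apply: eq_bigr => i _; rewrite expr2.
rewrite !dE.
under [X in _ <= _ * X]eq_bigr do rewrite mxE.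
apply: le_trans; rewrite le_eqVlt; apply/orP; left; apply/eqP.
apply: eq_bigr => i _; rewrite [in RHS]mxE; congr (_ ^+ 2).
by apply: eq_bigr => j _; rewrite [X in _ = _ * X]mxE.
Qed.

Lemma Amat_l2_contraction (v : 'I_p -> R) :
  \sum_i (\sum_j Amat s2 X i j * v j) ^+ 2 <= \sum_i v i ^+ 2.
Proof.
rewrite (le_trans (Amat_l2 v))// ler_piMl//.
  by apply: sumr_ge0 => i _; exact: sqr_ge0.
by rewrite exprn_ile1// ltW.
Qed.

(** The l2 contraction applied to the [i]-th basis vector bounds a column, which is a row by
    symmetry. *)
Lemma Amat_row_le1 i : \sum_j Amat s2 X i j ^+ 2 <= 1.
Proof.
have := Amat_l2_contraction (fun j => (j == i)%:R).
have -> : \sum_j ((j == i)%:R : R) ^+ 2 = 1.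
  rewrite (bigD1 i)//= eqxx expr1n big1 ?addr0// => j /negbTE ->.
  by rewrite expr0n.
apply: le_trans; rewrite le_eqVlt; apply/orP; left; apply/eqP.
apply: eq_bigr => k _; congr (_ ^+ 2); rewrite Amat_sym.
rewrite (bigD1 i)//= eqxx mulr1 big1 ?addr0// => j /negbTE ->.
by rewrite mulr0.
Qed.

End Interaction.

(** * Moments of a linear statistic, and their clipped versions *)

Section LinearStatistic.
Context {R : realType} (p : nat).
Variable q : 'cV[R]_p.
Local Notation T := (p.-tuple (Rmeas R)).

Lemma bm_dotv_clip_vec : bounded_measurable (fun b : T => dotv q (clip_vec b)).
Proof.
apply: bm_sum => i; apply: bmM; first exact: bm_cst.
rewrite (_ : (fun b => _) = xc i); first exact: bm_xc.
by apply/funext => b; rewrite mxE.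
Qed.

Lemma measurable_dotv_vec : measurable_fun setT (fun b : T => dotv q (vec b)).
Proof.
apply: measurable_sum => i; apply: measurable_funM => //.
rewrite (_ : (fun b => _) = (fun b => tnth b i)); first exact: measurable_tnth.
by apply/funext => b; rewrite mxE.
Qed.

Lemma int_dotv_clip_vec (P : probability T R) :
  \int[P]_b dotv q (clip_vec b) = \sum_i q i 0 * \int[P]_b xc i b.
Proof.
rewrite -[LHS]/(\int[P]_b \sum_i q i 0 * clip_vec b i 0).
transitivity (\int[P]_b \sum_i q i 0 * xc i b).
  by apply: eq_Rintegral => b _; apply: eq_bigr => i _; rewrite mxE.
rewrite bm_int_sum; last by move=> i; apply: bmM; [exact: bm_cst|exact: bm_xc].
by apply: eq_bigr => i _; rewrite bm_intZ//; exact: bm_xc.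
Qed.

Variable P : probability T R.
Hypothesis clipP : {ae P, forall b, clip_vec b = vec b}.

Lemma post_mean_clip : post_mean P q = \int[P]_b dotv q (clip_vec b).
Proof.
rewrite /post_mean unlock (bm_int_ae (f := fun b => dotv q (clip_vec b)))//.
- exact: bm_dotv_clip_vec.
- exact: measurable_dotv_vec.
- by apply: filterS clipP => b ->.
Qed.

Lemma expectation_sqr_clip a : ('E_P[fun b => ((dotv q (vec b) - a) ^+ 2)%R] =
  (\int[P]_b (dotv q (clip_vec b) - a) ^+ 2)%:E)%E.
Proof.
rewrite unlock (bm_int_ae (f := fun b => (dotv q (clip_vec b) - a) ^+ 2))//.
- by apply: bmX; apply: bmB; [exact: bm_dotv_clip_vec|exact: bm_cst].
- by apply: measurable_funX; apply: measurable_funB => //; exact: measurable_dotv_vec.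
- by apply: filterS clipP => b ->.
Qed.

(** The bias-variance identity. It makes the excess risk the exact square of the error in the
    posterior mean, so both claims of the theorem come from one estimate. *)
Lemma sqr_error_excess a : let m := \int[P]_b dotv q (clip_vec b) in
  \int[P]_b (dotv q (clip_vec b) - a) ^+ 2 -
  \int[P]_b (dotv q (clip_vec b) - m) ^+ 2 = (m - a) ^+ 2.
Proof.
move=> m; have bq := bm_dotv_clip_vec.
have b2 t : bounded_measurable (fun b => (dotv q (clip_vec b) - t) ^+ 2).
  by apply: bmX; apply: bmB => //; exact: bm_cst.
rewrite -bm_intB//.
transitivity (\int[P]_b (2 * (m - a) * dotv q (clip_vec b) + (a ^+ 2 - m ^+ 2))).
  by apply: eq_Rintegral => b _; ring.
rewrite bm_intD; [|by apply: bmM => //; exact: bm_cst|exact: bm_cst].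
by rewrite int_cst bm_intZ// -/m; ring.
Qed.

Lemma mean_vector_clip i : mean_vector P i 0 = \int[P]_b xc i b.
Proof.
rewrite mxE unlock (bm_int_ae (f := xc i))//.
- exact: bm_xc.
- exact: measurable_tnth.
- by apply: filterS clipP => b /matrixP /(_ i 0); rewrite !mxE.
Qed.

End LinearStatistic.

Lemma sqr_le_sum_sqr (R : realType) p (q : 'cV[R]_p) (w : 'I_p -> R) :
  norm2 q = 1 -> (\sum_i q i 0 * w i) ^+ 2 <= \sum_i w i ^+ 2.
Proof.
move=> q1; rewrite (le_trans (cauchy_schwarz_sum _ _))//.
have -> : \sum_i q i 0 ^+ 2 = norm2 q ^+ 2.
  by rewrite sqr_sqrtr// sumr_ge0// => i _; exact: sqr_ge0.
by rewrite q1 expr1n mul1r.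
Qed.

Theorem proposition2p4 (R : realType) (rho : R) (rho0 : 0 < rho)
    (rho1 : rho < 1) :
  exists C : R, 0 < C /\
    forall (mu : probability (Rmeas R) R)
      (mu_supp : supported11 mu)
      (mu_nondeg : forall a : R, mu [set a] <> 1%E)
      (s2 : R) (s2_gt0 : 0 < s2)
      (n p : nat) (X : 'M[R]_(n, p)) (y : 'cV[R]_n)
      (q : 'cV[R]_p) (q_norm : norm2 q = 1),
      opnorm4 (Amat s2 X) <= rho ->
      let nu := posterior mu s2 X y in
      let delta := post_mean nu q in
      forall Qprod : 'I_p -> probability (Rmeas R) R,
        mean_field_approx nu Qprod ->
        let u := mean_vector (prod_prob Qprod) in
        `|delta - dotv q u| <= C * Num.sqrt p%:R * alpha s2 X /\
        ('E_nu[fun b => ((dotv q (vec b) - dotv q u) ^+ 2)%R]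
         - 'E_nu[fun b => ((dotv q (vec b) - delta) ^+ 2)%R]
           <= (C * p%:R * alpha s2 X ^+ 2)%:E)%E.
Proof.
pose K : R := 144 * (92 * 438 ^+ 2) / (1 - rho) ^+ 6.
have K0 : 0 <= K.
  apply: divr_ge0; last by rewrite exprn_ge0// subr_ge0 ltW.
  by apply: mulr_ge0; [exact: ler0n|apply: mulr_ge0; [exact: ler0n|exact: sqr_ge0]].
(* One constant serves both claims: [1 + K] is positive, bounds [K] in the risk inequality, and has
   square at least [K], as the inequality for the means requires. *)
exists (1 + K); split; first by rewrite ltr_pwDl.
move=> mu mu_supp _ s2 s2_gt0 n p X y q q_norm Arho nu delta Q Qmf u.
pose A i j := Amat s2 X i j.
pose c := linear_coef s2 X y; pose d i := Sigma s2 X i i.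
have nuV := density_posterior s2 X y mu_supp.
have bV := bm_potential mu s2 X y.
have Vupd := potential_upd mu X y s2_gt0.
have fixpt := mean_field_fixpoint (c := c) (d := d) bV nuV Vupd mu_supp Qmf.
(* The posterior is dominated by the prior, so clipping is harmless under it as well. *)
have clipnu : {ae nu, forall b, clip_vec b = vec b}.
  have [N [mN N0 subN]] := supported11_clip_vec_ae (fun _ : 'I_p => mu_supp).
  exists N; split => //.
  by have /null_content_dominatesP := density_dominates nuV; apply.
have clipQ := supported11_clip_vec_ae Qmf.1.
have uE i : u i 0 = \int[Q i]_z clip z.
  by rewrite (mean_vector_clip clipQ) -(bm_int_marginal Q i (@bm_clip R)).
have sq_le : (delta - dotv q u) ^+ 2 <= K * (p%:R * alpha s2 X ^+ 2).
  have -> : delta - dotv q u = \sum_i q i 0 * (\int[nu]_b xc i b - \int[Q i]_z clip z).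
    rewrite /delta (post_mean_clip q clipnu) int_dotv_clip_vec /dotv -sumrB.
    by apply: eq_bigr => i _; rewrite mulrBr uE.
  rewrite (le_trans (sqr_le_sum_sqr _ q_norm))//.
  apply: (gibbs_mean_fixpoint_error (A := A) (c := c) (d := d) bV nuV Vupd) => //.
  - exact: Amat_diag.
  - exact: Amat_sym.
  - exact: (Amat_l2_contraction rho0 rho1 Arho).
  - exact: (Amat_row_le1 rho0 rho1 Arho).
  - exact: (Amat_l2 rho0 Arho).
  - exact: (Amat_l4 Arho).
  - exact: alpha_row.
have pa0 : 0 <= p%:R * alpha s2 X ^+ 2 :> R by rewrite mulr_ge0// sqr_ge0.
split.
  have a0 := alpha_ge0 s2 X.
  rewrite -(@ler_pXn2r _ 2)// ?nnegrE; last first.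
    by rewrite !mulr_ge0 ?sqrtr_ge0// addr_ge0.
  rewrite real_normK ?num_real// (le_trans sq_le)// !exprMn sqr_sqrtr// -mulrA.
  by rewrite ler_wpM2r// expr2 -[leLHS]mul1r ler_pM ?lerDl// lerDr.
rewrite !(expectation_sqr_clip q clipnu) -EFinB lee_fin.
have deltaE : delta = \int[nu]_b dotv q (clip_vec b) by exact: post_mean_clip.
rewrite deltaE sqr_error_excess -deltaE (le_trans sq_le)// -mulrA.
by rewrite ler_wpM2r// lerDr.
Qed.
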